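(* Let $f\in IV\cup III\cup II_a\cup II_b\cup II_c$ be either with real coefficients or in $II'_c$, and let $s_f$ be the standard even Real structure on $H_f$. The fixed point locus $H_f^{s_f}$ is diffeomorphic either to the torus $T^2$ or to a Klein bottle, according to whether the determinant of the real part of $f$ is positive or negative. In particular, if $f\in II'_c$, then $H_f^{s_f}$ is a torus.
   Context: $W=\mathbb{C}^2\setminus\{0\}$; $H_f=W/\langle f\rangle$. Classes of contractions of $W$: - $IV$: $f(z,w)=(\alpha z,\alpha w)$, $0<|\alpha|<1$; - $III$: $f(z,w)=(\delta^r z,\delta w)$, $r\in\mathbb{N}$, $r\ge 2$, $0<|\delta|<1$; - $II_a$: $f(z,w)=(\delta^r z+w^r,\delta w)$, $r\in\mathbb{N}$, $r\ge2$, $0<|\delta|<1$; - $II_b$: $f(z,w)=(\alpha z+w,\alpha w)$, $0<|\alpha|<1$; - $II_c$: $f(z,w)=(\alpha z,\delta w)$, $0<|\alpha|<1$, $0<|\delta|<1$, $\alpha\ne\delta^r$ for all $r\in\mathbb{N}$; - $II'_c\subset II_c$: $f(z,w)=(\alpha z,\bar\alpha w)$, $0<|\alpha|<1$, $\alpha\notin\mathbb{R}$. The standard Real structure $s_f$ is the anti-holomorphic involution of $H_f$ induced by $c(z,w)=(\bar z,\bar w)$ if $f$ has real coefficients, and by $c'(z,w)=(\bar w,\bar z)$ if $f\in II'_c$. The real part of $f$ is the contraction induced by $f$ on $W^c=\mathbb{R}^2\setminus\{0\}$ (respectively on $W^{c'}=\{(z,\bar z)\mid z\in\mathbb{C}^*\}\cong\mathbb{R}^2\setminus\{0\}$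 if $f\in II'_c$); its determinant is its (real) Jacobian determinant, which is constant, equal to the product of the two diagonal coefficients of $f$. *)

(* Defs.v *)
From Stdlib Require Import Relations.
From mathcomp Require Import all_boot all_order all_algebra.
From mathcomp Require Import all_classical all_reals all_analysis.
From mathcomp Require Import complex.
Import Order.TTheory GRing.Theory Num.Theory.
Import numFieldNormedType.Exports.

Set Implicit Arguments.
Unset Strict Implicit.
Unset Printing Implicit Defensive.

Local Open Scope classical_set_scope.
Local Open Scope complex_scope.
Local Open Scope ring_scope.

(** * C^oo maps between open subsets of Euclidean spaces *)

Fixpoint Ck_on (R : realType) (n k : nat) (U : set 'rV[R]_n)
    (g : 'rV[R]_n -> R^o) : Prop :=
  (forall x, U x -> {for x, continuous g}) /\
  match k with
  | 0 => True
  | k'.+1 => forall i : 'I_n,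
      (forall x, U x -> derivable g x (delta_mx 0 i)) /\
      Ck_on k' U (fun x => 'D_(delta_mx 0 i) g x)
  end.

Definition Cinfty_on (R : realType) (m n : nat) (U : set 'rV[R]_m)
    (g : 'rV[R]_m -> 'rV[R]_n) : Prop :=
  forall (j : 'I_n) (k : nat), Ck_on k U (fun x => g x 0 j).

(** * Manifolds given by local parametrizations *)

(* As in do Carmo, a chart is a parametrization: an open subset U of R^n
   together with a map into T that is injective on U.  The map is total, but
   only its values on U matter.  Covering and smooth compatibility of charts are
   not fields of the record: the spaces used below are orbit spaces of free,
   properly discontinuous groups of diffeomorphisms, where they hold. *)
Record charted_space (R : realType) (n : nat) (T : Type) := ChartedSpace {
  points : set T;
  charts : set (set 'rV[R]_n * ('rV[R]_n -> T))
}.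

(* F, regarded as a map on the subset S of M, is smooth at p: read in charts
   around p and F p, it agrees near p with the restriction to S of a C^oo
   map.  For S = points M this is ordinary smoothness at p. *)
Definition smooth_at (R : realType) (m n : nat) (T T' : Type)
    (M : charted_space R m T) (S : set T) (N : charted_space R n T')
    (F : T -> T') (p : T) : Prop :=
  exists U x V y, charts M (U, x) /\ charts N (V, y) /\
  exists u (A : set 'rV[R]_m) (G : 'rV[R]_m -> 'rV[R]_n),
    [/\ x u = p, open A, A u & A `<=` U] /\
    [/\ G @` A `<=` V, Cinfty_on A G &
        forall a, A a -> S (x a) -> F (x a) = y (G a)].

Definition smooth_on (R : realType) (m n : nat) (T T' : Type)
    (M : charted_space R m T) (S : set T) (N : charted_space R n T')
    (F : T -> T') : Prop :=
  forall p, S p -> smooth_at M S N F p.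

(* Diffeomorphism between subsets of manifolds, in Milnor's sense; when S and
   S' are submanifolds it is a diffeomorphism for the submanifold structures. *)
Definition diffeomorphic (R : realType) (m n : nat) (T T' : Type)
    (M : charted_space R m T) (S : set T)
    (N : charted_space R n T') (S' : set T') : Prop :=
  exists (F : T -> T') (G : T' -> T),
    [/\ F @` S `<=` S', G @` S' `<=` S,
        {in S, cancel F G} & {in S', cancel G F}] /\
    smooth_on M S N F /\ smooth_on N S' M G.

(** * Orbit spaces *)

(* For a set gens of bijections of X, this is the orbit of a under the group
   they generate: the equivalence closure also inverts the generators. *)
Definition group_orbit (X : Type) (gens : set (X -> X)) (a : X) : set X :=
  [set b | clos_refl_sym_trans X (fun u v => exists2 g, gens g & v = g u) a b].

(* The quotient of an invariant subset Omega of X, where coord : R^n -> X is a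
   linear coordinate system.  Its charts are the restrictions of the projection
   to the open sets on which it is injective; on overlaps they differ locally
   by elements of the group. *)
Definition orbit_space (R : realType) (n : nat) (X : Type)
    (coord : 'rV[R]_n -> X) (Omega : set X) (gens : set (X -> X)) :
    charted_space R n (set X) :=
  ChartedSpace
    (group_orbit gens @` Omega)
    [set c | [/\ open c.1, coord @` c.1 `<=` Omega,
                 c.2 = group_orbit gens \o coord & {in c.1 &, injective c.2}]].

Definition vec2 (R : realType) (x y : R) : 'rV[R]_2 :=
  \row_(j < 2) if j == 0 then x else y.

Definition torus (R : realType) : charted_space R 2 (set 'rV[R]_2) :=
  orbit_space id setT
    [set (fun v : 'rV[R]_2 => vec2 (v 0 0 + 1) (v 0 1));
         (fun v : 'rV[R]_2 => vec2 (v 0 0) (v 0 1 + 1))].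

Definition klein_bottle (R : realType) : charted_space R 2 (set 'rV[R]_2) :=
  orbit_space id setT
    [set (fun v : 'rV[R]_2 => vec2 (v 0 0 + 1) (v 0 1));
         (fun v : 'rV[R]_2 => vec2 (- v 0 0) (v 0 1 + 1))].

(** * Contractions of C^2 minus the origin and Hopf surfaces *)

Inductive normal_form (R : realType) :=
| IV of R[i]
| III of nat & R[i]
| IIa of nat & R[i]
| IIb of R[i]
| IIc of R[i] & R[i].

Definition admissible (R : realType) (f : normal_form R) : Prop :=
  match f with
  | IV alpha => 0 < `|alpha| < 1
  | III r delta => (2 <= r)%N /\ 0 < `|delta| < 1
  | IIa r delta => (2 <= r)%N /\ 0 < `|delta| < 1
  | IIb alpha => 0 < `|alpha| < 1
  | IIc alpha delta => [/\ 0 < `|alpha| < 1, 0 < `|delta| < 1 &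
                           forall r : nat, alpha <> delta ^+ r]
  end.

Definition cmap (R : realType) (f : normal_form R) (p : R[i] * R[i]) :
    R[i] * R[i] :=
  let: (z, w) := p in
  match f with
  | IV alpha => (alpha * z, alpha * w)
  | III r delta => (delta ^+ r * z, delta * w)
  | IIa r delta => (delta ^+ r * z + w ^+ r, delta * w)
  | IIb alpha => (alpha * z + w, alpha * w)
  | IIc alpha delta => (alpha * z, delta * w)
  end.

(* The coefficients other than 0 and 1 are the two diagonal ones. *)
Definition real_coefs (R : realType) (f : normal_form R) : bool :=
  match f with
  | IV alpha => alpha \is Num.real
  | III r delta => (delta ^+ r \is Num.real) && (delta \is Num.real)
  | IIa r delta => (delta ^+ r \is Num.real) && (delta \is Num.real)
  | IIb alpha => alpha \is Num.real
  | IIc alpha delta => (alpha \is Num.real) && (delta \is Num.real)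
  end.

Definition in_IIc' (R : realType) (f : normal_form R) : Prop :=
  exists alpha : R[i], [/\ f = IIc alpha (alpha^*),
                           0 < `|alpha| < 1 & alpha \isn't Num.real].

Definition W (R : realType) : set (R[i] * R[i]) := [set p | p <> (0, 0)].

Definition C2coord (R : realType) (v : 'rV[R]_4) : R[i] * R[i] :=
  (v 0 0 +i* v 0 1, v 0 2 +i* v 0 3).

Definition hopf (R : realType) (f : normal_form R) :
    charted_space R 4 (set (R[i] * R[i])) :=
  orbit_space (@C2coord R) (@W R) [set cmap f].

(* c in the case of real coefficients and c' otherwise; f is in II'_c then. *)
Definition std_conj (R : realType) (f : normal_form R) (p : R[i] * R[i]) :
    R[i] * R[i] :=
  if real_coefs f then (p.1^*, p.2^*) else (p.2^*, p.1^*).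

(* The map induced on orbits. *)
Definition std_real_structure (R : realType) (f : normal_form R)
    (O : set (R[i] * R[i])) : set (R[i] * R[i]) :=
  std_conj f @` O.

Definition fixed_locus (R : realType) (f : normal_form R) :
    set (set (R[i] * R[i])) :=
  [set O | points (hopf f) O /\ std_real_structure f O = O].

(* The identification of R^2 with the fixed set of std_conj f in C^2:
   (x, y) |-> (x, y), respectively (x, y) |-> (x + iy, x - iy). *)
Definition real_embed (R : realType) (f : normal_form R) (v : 'rV[R]_2) :
    R[i] * R[i] :=
  if real_coefs f then ((v 0 0)%:C, (v 0 1)%:C)
  else (v 0 0 +i* v 0 1, (v 0 0 +i* v 0 1)^*).

Definition real_coord (R : realType) (f : normal_form R) (p : R[i] * R[i]) :
    'rV[R]_2 :=
  if real_coefs f then vec2 (complex.Re p.1) (complex.Re p.2)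
  else vec2 (complex.Re p.1) (complex.Im p.1).

Definition real_part (R : realType) (f : normal_form R) (v : 'rV[R]_2) :
    'rV[R]_2 :=
  real_coord f (cmap f (real_embed f v)).

Definition real_part_det (R : realType) (f : normal_form R)
    (v : 'rV[R]_2) : R :=
  \det (jacobian (real_part f) v).

(* Main.v *)
(* A point whose orbit is preserved by the real structure satisfies
   conj p = f^n p, hence f^(2n) p = p, hence n = 0: the fixed locus is the orbit
   space of the real part of f on the punctured plane.  Write the real part as
   the composite of a commuting orthogonal map with the time-one map of a flow,
   (x, y) |-> (e^(-pt) (x + t k y^r), e^(-qt) y) after rescaling x.  For a
   suitable scale the quasi-norm x^2 + y^(2r) strictly decreases along the flow,
   so every trajectory crosses the curve x^2 + y^(2r) = 1 exactly once, at a time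
   that is smooth by implicit differentiation.  Angle on the curve and time are
   then global coordinates (s, t), s modulo 1, in which the real part becomes
   (s, t) |-> (tau + s, t + 1) or (tau - s, t + 1) according to the sign of its
   determinant; a linear change of coordinates gives the torus or the Klein
   bottle. *)
From Stdlib Require Import Relations.
From HB Require Import structures.
Require Import Defs.
From mathcomp Require Import all_boot all_order all_algebra.
From mathcomp Require Import all_classical all_reals all_analysis.
From mathcomp Require Import complex ring lra.
Import Order.TTheory GRing.Theory Num.Theory.
Import numFieldNormedType.Exports.

Set Implicit Arguments.
Unset Strict Implicit.
Unset Printing Implicit Defensive.

Local Open Scope classical_set_scope.
Local Open Scope complex_scope.
Local Open Scope ring_scope.

(** * Calculus of C^k functions *)

(** The delicate case is the resonant one, where the real part is (a x + y^r, d y) with a = d^r. The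
    logarithm of the shear brings the factor t into the flow, and the resulting cross term in the
    derivative of the quasi-norm has no sign. Rescaling x changes [k] by a factor, so [k] can be
    brought to absolute value [p], where the cross term consumes at most half of the contraction.
    The other half is an exponential rate, which gives existence and uniqueness of the crossing.
    Regularity comes from derivative formulas that involve the function itself: if the function is
    C^n, so is its derivative, hence the function is C^(n+1). This serves exp, inverse, square root,
    the pair cos, sin and the crossing time alike. The angle has no continuous real branch on the
    punctured plane, so the two quotients are compared as sets of orbits, and smoothness is checked
    with local sections only. On the fixed locus, a surface in a real 4-manifold, smoothness asks
    for extensions to open sets of R^4; ignoring two of the four real coordinates provides them. *)

Lemma near_eq_continuous (S T : topologicalType) (f g : S -> T) (x : S) :
  {near x, f =1 g} -> {for x, continuous f} -> {for x, continuous g}.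
Proof.
move=> fg cf; rewrite /prop_for /continuous_at -(nbhs_singleton fg).
by apply: cvg_trans cf; apply: near_eq_cvg; apply: filterS fg => y ->.
Qed.

Section CkCalculus.
Variables (R : realType) (n : nat).
Implicit Types (U A : set 'rV[R]_n) (f g : 'rV[R]_n -> R) (k : nat).

(** A directional derivative is an ordinary derivative at 0 along the line [t *: v + x], so the
    one-variable chain rule applies. *)
Lemma is_derive_comp1 (f : R -> R) g (x v : 'rV[R]_n) (a b : R) :
  is_derive (g x) 1 f a -> is_derive x v (g : _ -> R^o) b ->
  is_derive x v (f \o g : _ -> R^o) (a * b).
Proof.
move=> df [dg gb].
have lineE (h : 'rV[R]_n -> R) :
    'D_v (h : _ -> R^o) x = 'D_1 (fun t : R => h (t *: v + x) : R^o) 0.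
  rewrite /derive; set g1 := fun t => t^-1 *: _; set g2 := fun t => t^-1 *: _.
  suff -> : g1 = g2 by [].
  by apply/funext => t; rewrite /g1 /g2 /= addr0 scale0r add0r [_%:A]mulr1.
have H : is_derive (0 : R) 1 (fun t : R => g (t *: v + x) : R^o) b.
  split; last by rewrite -gb lineE.
  exact: (derivable1P (g : _ -> R^o) x v).1.
have df0 : is_derive (g (0 *: v + x)) 1 f a by rewrite scale0r add0r.
have [d1 d2] := is_derive1_comp df0 H.
split; last by rewrite lineE.
exact: (derivable1P (f \o g : _ -> R^o) x v).2.
Qed.

Lemma Ck_cont k U f : Ck_on k U f -> forall x, U x -> {for x, continuous f}.
Proof. by case: k => [|k] []. Qed.

Lemma Ck_ext k U f g : open U -> (forall x, U x -> f x = g x) ->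
  Ck_on k U f -> Ck_on k U g.
Proof.
move=> oU; elim: k f g => [|k IH] f g fg [cf df].
all: have nE x : U x -> {near x, f =1 g}
  by [move=> Ux; near=> y; apply: fg; near: y; exact: open_nbhs_nbhs].
all: have cg x : U x -> {for x, continuous g}
  by [move=> Ux; apply: near_eq_continuous (nE x Ux) (cf x Ux)].
  by [].
split => // j; have [dfj Cfj] := df j; split => [x Ux|].
  by apply: (near_eq_derivable (nE x Ux)); exact: dfj.
apply: IH Cfj => x Ux; apply: near_eq_derive.
exact: nE.
Unshelve. all: by end_near. Qed.

(** Replaces the abstract partial derivatives by explicit candidates [G], so that inductions on [k]
    run on formulas. *)
Lemma CkS_intro k U f (G : 'I_n -> 'rV[R]_n -> R) :
    open U ->
    (forall x, U x -> {for x, continuous f}) ->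
    (forall x, U x -> forall i, is_derive x (delta_mx 0 i) (f : _ -> R^o) (G i x)) ->
    (forall i, Ck_on k U (G i)) -> Ck_on k.+1 U f.
Proof.
move=> oU cf dG CG; split => // i; split => [x Ux|].
  by have [] := dG x Ux i.
by apply: Ck_ext (CG i) => // x Ux; have [] := dG x Ux i.
Qed.

Lemma CkW k U f : Ck_on k.+1 U f -> Ck_on k U f.
Proof.
elim: k f => [|k IH] f [cf df]; split => // i.
by have [dfi Cfi] := df i; split => //; exact: IH.
Qed.

Lemma CkS_elim k U f : Ck_on k.+1 U f ->
  (forall x, U x -> forall i, is_derive x (delta_mx 0 i) (f : _ -> R^o)
     ('D_(delta_mx 0 i) (f : _ -> R^o) x)) /\
  (forall i, Ck_on k U (fun x => 'D_(delta_mx 0 i) (f : _ -> R^o) x : R)).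
Proof.
move=> [cf df]; split => [x Ux i|i]; last by have [] := df i.
by apply: derivableP; have [+ _] := df i; exact.
Qed.

Lemma Ck_sub k U A f : A `<=` U -> Ck_on k U f -> Ck_on k A f.
Proof.
move=> AU; elim: k f => [|k IH] f [cf df]; split => //.
- by move=> x /AU; exact: cf.
- by move=> x /AU; exact: cf.
- by move=> i; have [dfi Cfi] := df i; split => [x /AU|]; [exact: dfi|exact: IH].
Qed.

Lemma Ck_cst k U (a : R) : Ck_on k U (fun=> a).
Proof.
elim: k a => [|k IH] a; split => //; try by move=> x _; exact: cst_continuous.
move=> i; split => [x _|]; first exact: derivable_cst.
rewrite (_ : (fun x => _) = fun=> 0 :> R); first exact: IH.
by apply/funext => x; exact: derive_cst.
Qed.

Lemma is_derive_coord (x v : 'rV[R]_n) (j : 'I_n) :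
  is_derive x v (fun u : 'rV[R]_n => u 0 j : R^o) (v 0 j).
Proof.
have dj : differentiable (fun u : 'rV[R]_n => u 0 j : R^o) x.
  exact: differentiable_coord.
split; first exact: diff_derivable.
rewrite deriveE //.
have lin : linear (fun u : 'rV[R]_n => u 0 j : R^o) by move=> a u w; rewrite !mxE.
pose l : {linear 'rV[R]_n -> R^o} :=
  HB.pack (fun u : 'rV[R]_n => u 0 j : R^o) (GRing.isLinear.Build _ _ _ _ _ lin).
rewrite (@diff_lin _ _ _ l) //; exact: coord_continuous.
Qed.

Lemma Ck_coord k U (j : 'I_n) : open U -> Ck_on k U (fun u : 'rV[R]_n => u 0 j).
Proof.
move=> oU; have c x : U x -> {for x, continuous (fun u : 'rV[R]_n => u 0 j)}.
  by move=> _; exact: coord_continuous.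
case: k => [//|k].
apply: (CkS_intro (G := fun i _ => (delta_mx 0 i : 'rV[R]_n) 0 j)) => //.
  by move=> x Ux i; exact: is_derive_coord.
by move=> i; exact: Ck_cst.
Qed.

Lemma CkD k U f g : open U -> Ck_on k U f -> Ck_on k U g ->
  Ck_on k U (fun x => f x + g x).
Proof.
move=> oU; elim: k f g => [|k IH] f g Cf Cg.
  by split => // x Ux; exact: (continuousD (Ck_cont Cf Ux) (Ck_cont Cg Ux)).
have [df Cdf] := CkS_elim Cf; have [dg Cdg] := CkS_elim Cg.
apply: (CkS_intro oU _ (fun x Ux i => is_deriveD (df x Ux i) (dg x Ux i))) => [x Ux|i].
  by exact: (continuousD (Ck_cont Cf Ux) (Ck_cont Cg Ux)).
by apply: IH; [exact: Cdf|exact: Cdg].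
Qed.

Lemma CkM k U f g : open U -> Ck_on k U f -> Ck_on k U g ->
  Ck_on k U (fun x => f x * g x).
Proof.
move=> oU; elim: k f g => [|k IH] f g Cf Cg.
  by split => // x Ux; exact: (continuousM (Ck_cont Cf Ux) (Ck_cont Cg Ux)).
have [df Cdf] := CkS_elim Cf; have [dg Cdg] := CkS_elim Cg.
apply: (CkS_intro oU _ (fun x Ux i => is_deriveM (df x Ux i) (dg x Ux i))) => [x Ux|i].
  by exact: (continuousM (Ck_cont Cf Ux) (Ck_cont Cg Ux)).
apply: (CkD oU); apply: IH; by [exact: CkW|exact: Cdf|exact: Cdg].
Qed.

Lemma CkZ k U (a : R) f : open U -> Ck_on k U f -> Ck_on k U (fun x => a * f x).
Proof. by move=> oU; apply: CkM => //; exact: Ck_cst. Qed.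

Lemma CkN k U f : open U -> Ck_on k U f -> Ck_on k U (fun x => - f x).
Proof.
move=> oU Cf; apply: (Ck_ext oU _ (CkZ (-1) oU Cf)) => x _.
by rewrite mulN1r.
Qed.

Lemma CkB k U f g : open U -> Ck_on k U f -> Ck_on k U g ->
  Ck_on k U (fun x => f x - g x).
Proof. by move=> oU Cf Cg; apply: CkD => //; exact: CkN. Qed.

Lemma CkX k U f m : open U -> Ck_on k U f -> Ck_on k U (fun x => f x ^+ m).
Proof.
move=> oU Cf; elim: m => [|m IH]; first exact: Ck_cst.
apply: (Ck_ext oU _ (CkM oU Cf IH)) => x _.
by rewrite exprS.
Qed.

Lemma Ck_sum (I : Type) (s : seq I) k U (F : I -> 'rV[R]_n -> R) : open U ->
  (forall i, Ck_on k U (F i)) -> Ck_on k U (fun x => \sum_(i <- s) F i x).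
Proof.
move=> oU CF; elim: s => [|i s IH].
  by apply: (Ck_ext oU _ (Ck_cst k U 0)) => x _; rewrite big_nil.
by apply: (Ck_ext oU _ (CkD oU (CF i) IH)) => x _; rewrite big_cons.
Qed.

(* Chain rule for a family [h] closed under derivation on [D]; the derivative of
   [h i] may involve [h] itself, which is what exp, 1/x, (cos, sin) need. *)
Lemma Ck_comp1 (I : Type) (D : set R) (h : I -> R -> R) (h' : I -> R -> R) U g :
    open U -> (forall x, U x -> D (g x)) ->
    (forall i t, D t -> is_derive t 1 (h i) (h' i t)) ->
    (forall k, Ck_on k U g -> (forall i, Ck_on k U (h i \o g)) ->
       forall i, Ck_on k U (h' i \o g)) ->
  forall k, Ck_on k U g -> forall i, Ck_on k U (h i \o g).
Proof.
move=> oU gD dh Ch.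
have cg k : Ck_on k U g -> forall i x, U x -> {for x, continuous (h i \o g)}.
  move=> Cg i x Ux; apply: (@continuous_comp _ _ _ g (h i) x (Ck_cont Cg Ux)).
  have [+ _] := dh i _ (gD x Ux).
  by move=> /derivable1_diffP/differentiable_continuous.
elim=> [|k IH] Cg i; first by split => // x Ux; exact: cg Cg _ _ Ux.
have [dg Cdg] := CkS_elim Cg.
apply: (CkS_intro oU (cg _ Cg i)
  (fun x Ux j => is_derive_comp1 (dh i _ (gD x Ux)) (dg x Ux j))) => j.
by apply: CkM => //; apply: Ch; [exact: CkW|move=> l; apply: IH; exact: CkW].
Qed.

Lemma Ck_expR k U g : open U -> Ck_on k U g -> Ck_on k U (fun x => expR (g x)).
Proof.
move=> oU Cg.
apply: (@Ck_comp1 unit setT (fun=> expR) (fun=> expR) U g oU _ _ _ k Cg tt) => //.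
Qed.

Lemma Ck_inv k U g : open U -> (forall x, U x -> g x != 0) -> Ck_on k U g ->
  Ck_on k U (fun x => (g x)^-1).
Proof.
move=> oU g0 Cg.
apply: (@Ck_comp1 unit [set t | t != 0] (fun _ t => t^-1)
  (fun _ t => - (t^-1 * t^-1)) U g oU _ _ _ k Cg tt) => //.
- move=> _ t /= t0; split; first exact: (@derivableV _ _ id).
  by rewrite (@deriveV _ _ id) // derive_id /GRing.scale/= mulr1 -exprVn expr2.
- by move=> j Cj Ch _; apply: CkN => //; apply: CkM => //; exact: (Ch tt).
Qed.

Lemma Ck_cos_sin k U g : open U -> Ck_on k U g ->
  Ck_on k U (fun x => cos (g x)) /\ Ck_on k U (fun x => sin (g x)).
Proof.
move=> oU Cg.
pose h b : R -> R := if b then @cos R else @sin R.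
have := @Ck_comp1 bool setT h (fun b t => if b then - sin t else cos t) U g oU.
move=> /(_ (fun _ _ => I)) H.
have {}H := H _ _ k Cg; split.
- apply: (H _ _ true) => [[] t _|j Cj Cjh []]; [exact: is_derive_cos|exact: is_derive_sin| |].
    by apply: CkN => //; exact: (Cjh false).
  exact: (Cjh true).
- apply: (H _ _ false) => [[] t _|j Cj Cjh []]; [exact: is_derive_cos|exact: is_derive_sin| |].
    by apply: CkN => //; exact: (Cjh false).
  exact: (Cjh true).
Qed.

Lemma Ck_atan k U g : open U -> Ck_on k U g -> Ck_on k U (fun x => atan (g x)).
Proof.
move=> oU Cg.
apply: (@Ck_comp1 unit setT (fun=> atan) (fun _ t => (1 + t ^+ 2)^-1) U g oU _ _ _ k Cg tt) => //.
move=> j Cj _ _; apply: Ck_inv => //.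
  by move=> x _; rewrite gt_eqF// ltr_wpDr ?sqr_ge0.
by apply: CkD => //; [exact: Ck_cst|exact: CkX].
Qed.

Lemma Ck_sqrt k U g : open U -> (forall x, U x -> 0 < g x) -> Ck_on k U g ->
  Ck_on k U (fun x => Num.sqrt (g x)).
Proof.
move=> oU g0 Cg.
apply: (@Ck_comp1 unit [set t | 0 < t] (fun=> Num.sqrt)
  (fun _ t => (2 * Num.sqrt t)^-1) U g oU _ _ _ k Cg tt) => //.
move=> j Cj Ch _; apply: Ck_inv => //.
  by move=> x Ux; rewrite mulf_neq0// gt_eqF// sqrtr_gt0 g0.
by apply: CkZ => //; exact: (Ch tt).
Qed.

End CkCalculus.

(** * Growth and implicit differentiation *)

Lemma nonneg_derive_homo (R : realType) (f df : R -> R) :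
  (forall t : R, is_derive t 1 f (df t)) -> (forall t, 0 <= df t) ->
  {homo f : s t / s <= t}.
Proof.
move=> dfE df0 s t st.
have fd u : derivable f u 1 by have [] := dfE u.
apply: (@ger0_derive1_ndecr _ f s t) => // [x _|].
  by rewrite derive1E; have [_ ->] := dfE x.
apply: continuous_subspaceT => x.
by apply/differentiable_continuous/derivable1_diffP.
Qed.

Section ExponentialGrowth.
Variables (R : realType) (g dg : R -> R) (c : R).
Hypothesis c_gt0 : 0 < c.
Hypothesis g_gt0 : forall t, 0 < g t.
Hypothesis dgE : forall t : R, is_derive t 1 g (dg t).
Hypothesis dg_ge : forall t, c * g t <= dg t.

(** Gronwall's argument: [g t * expR (- c * t)] has a nonnegative derivative. *)
Lemma growth_le s t : s <= t -> g s * expR (c * (t - s)) <= g t.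
Proof.
move=> st.
pose G t := g t * expR (- c * t).
have GE (u : R) : is_derive u 1 G ((dg u - c * g u) * expR (- c * u)).
  have d1 : is_derive u 1 (fun t : R => - c * t) (- c).
    by apply: is_derive_eq; rewrite -[RHS]mulr1.
  have d2 := is_derive1_comp (is_derive_expR (- c * u)) d1.
  apply: (is_derive_eq (is_deriveM (dgE u) d2)).
  by rewrite /GRing.scale/= ; ring.
have := nonneg_derive_homo GE.
have H u : 0 <= (dg u - c * g u) * expR (- c * u).
  by rewrite mulr_ge0 ?expR_ge0// subr_ge0.
move=> /(_ H _ _ st); rewrite /G.
rewrite -(ler_pM2r (expR_gt0 (c * t))) -!mulrA -!expRD.
rewrite (_ : - c * s + c * t = c * (t - s)); last by ring.
by rewrite (_ : - c * t + c * t = 0) ?expR0 ?mulr1//; ring.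
Qed.

Lemma growth_lt s t : s < t -> g s < g t.
Proof.
move=> st; apply: lt_le_trans (growth_le (ltW st)).
by rewrite ltr_pMr// expR_gt1 mulr_gt0// subr_gt0.
Qed.

Lemma growth_eq1 : exists t, g t = 1.
Proof.
have cg t : {for t, continuous g}.
  by have [+ _] := dgE t => /derivable1_diffP/differentiable_continuous.
(* With [expR x >= 1 + x], the exponential factor is at least [g 0] over the interval from [a] to 0,
   and at least [(g 0)^-1] from 0 to [b]; hence [g a <= 1 <= g b]. *)
pose a := - (g 0 / c); pose b := (c * g 0)^-1.
have ga : g a <= 1.
  have a0 : a <= 0 by rewrite oppr_le0 divr_ge0 ?ltW.
  have := growth_le a0; rewrite sub0r /a opprK mulrCA divff ?gt_eqF// mulr1 -/a.
  rewrite -ler_pdivlMr ?expR_gt0// => /le_trans; apply.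
  rewrite ler_pdivrMr ?expR_gt0// mul1r.
  by apply: le_trans (expR_ge1Dx _); rewrite lerDr.
have gb : 1 <= g b.
  have b0 : 0 <= b by rewrite invr_ge0 mulr_ge0 ?ltW.
  apply: le_trans (growth_le b0); rewrite subr0 /b invfM mulrA divff ?gt_eqF// mul1r.
  rewrite -ler_pdivrMl// mulr1; apply: le_trans (expR_ge1Dx _).
  by rewrite lerDr.
have ab : a <= b.
  by rewrite (@le_trans _ _ 0) ?oppr_le0 ?divr_ge0 ?invr_ge0 ?mulr_ge0 ?ltW.
have [t _ gt] := @IVT R g a b 1 ab (continuous_subspaceT cg)
  ltac:(rewrite ge_min ga le_max gb orbT//).
by exists t.
Qed.

End ExponentialGrowth.

(** Only continuity of [tau] is assumed; its differentiability is a conclusion. With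
    [D h = tau h - tau 0], the first-order expansion of [F] bounds [D h * A + h * B] by
    [e * (|D h| + |h|)] for every [e > 0]. One fixed [e] gives [D h = O(h)]; with that bound,
    arbitrary [e] gives the limit of [D h / h]. *)
Lemma is_derive_implicit (R : realType) (F : R * R -> R) (tau : R -> R) (A B : R) :
    {for 0, continuous tau} ->
    (\forall h \near (0 : R), F (tau h, h) = F (tau 0, 0)) ->
    differentiable (F : _ -> R^o) (tau 0, 0 : R) ->
    is_derive (tau 0) 1 (fun t => F (t, 0)) A ->
    is_derive (0 : R) 1 (fun h => F (tau 0, h)) B -> A != 0 ->
  is_derive (0 : R) 1 tau (- B / A).
Proof.
move=> ctau Fcst dF [dA AE] [dB BE] A0.
have dFE (a b : R) : 'd (F : _ -> R^o) (tau 0, 0 : R) (a, b) = a * A + b * B.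
  have -> : (a, b) = a *: ((1, 0) : R * R) + b *: ((0, 1) : R * R).
    rewrite -[RHS]/(a * 1 + b * 0, a * 0 + b * 1).
    by rewrite !mulr1 !mulr0 addr0 add0r.
  rewrite linearD !linearZ /= -!deriveE // /GRing.scale /=; congr (_ * _ + _ * _).
    rewrite -AE /derive; set g1 := fun t => t^-1 *: _; set g2 := fun t => t^-1 *: _.
    suff -> : g1 = g2 by [].
    apply/funext => t; rewrite /g1 /g2 /=.
    congr (_ *: (F _ - _)); congr pair.
    by rewrite [LHS](_ : _ = t * 0 + 0) // mulr0 addr0.
  rewrite -BE /derive; set g1 := fun t => t^-1 *: _; set g2 := fun t => t^-1 *: _.
  suff -> : g1 = g2 by [].
  apply/funext => t; rewrite /g1 /g2 /=.
  congr (_ *: (F _ - _)); congr pair.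
  by rewrite [LHS](_ : _ = t * 0 + tau 0) // mulr0 add0r.
pose D h := tau h - tau 0.
have D0 : D h @[h --> (0 : R)] --> (0 : R).
  by rewrite -[X in _ --> X](subrr (tau 0)); exact: (cvgB ctau (cvg_cst _)).
have lin e : 0 < e -> \forall h \near (0 : R), `|D h * A + h * B| <= e * (`|D h| + `|h|).
  move=> e0.
  have /eqaddoP/(_ e e0) /= := diff_locally dF.
  have c0 : (D h, h) @[h --> (0 : R)] --> (0 : R * R).
    apply: cvg_trans (cvg_pair D0 (@cvg_id _ (nbhs (0 : R)))) => //.
  move=> /c0; apply: filterS2 Fcst => h Fh /=.
  have -> : (F \o +%R^~ (tau 0, 0 : R) - (cst (F (tau 0, 0)) + 'd (F : _ -> R^o) (tau 0, 0 : R))) (D h, h)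
      = - (D h * A + h * B).
    rewrite -dFE -[LHS]/(F (D h + tau 0, h + 0) - (F (tau 0, 0) + _)).
    by rewrite subrK addr0 Fh opprD addrA subrr sub0r.
  rewrite normrN => /le_trans; apply; rewrite ler_pM2l//.
  by rewrite prod_normE/= ge_max lerDl lerDr !normr_ge0.
have A_gt0 : 0 < `|A| by rewrite normr_gt0.
(* The estimate with [e = |A| / 2] reads [|A| |D h| <= |A| / 2 * (|D h| + |h|) + |B| |h|]; solving
   for [|D h|] gives this constant. *)
pose C := (2 * `|B| + `|A|) / `|A|.
have C_ge0 : 0 <= C by rewrite divr_ge0// addr_ge0// mulr_ge0.
have DO : \forall h \near (0 : R), `|D h| <= C * `|h|.
  have A2 : 0 < `|A| / 2 by rewrite divr_gt0.
  apply: filterS (lin _ A2) => h H.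
  have H2 : `|D h * A| <= `|D h * A + h * B| + `|h * B|.
    by rewrite -[X in `|X| <= _](addrK (h * B)) ler_normB.
  rewrite /C mulrAC ler_pdivlMr//.
  move: H H2; rewrite !normrM; nra.
have cvgD : h^-1 *: (tau (h *: 1 + 0) - tau 0) @[h --> 0^'] --> - B / A.
  apply/cvgrPdist_le => e e0.
  have e1 : 0 < e * `|A| / (C + 1) by rewrite divr_gt0 ?mulr_gt0// ltr_wpDl.
  near=> h.
  have h0 : h != 0 by near: h; exact: nbhs_dnbhs_neq.
  have Dh : `|D h| <= C * `|h| by near: h; exact: nbhs_dnbhs DO.
  have Lh : `|D h * A + h * B| <= e * `|A| / (C + 1) * (`|D h| + `|h|).
    by near: h; exact: nbhs_dnbhs (lin _ e1).
  rewrite addr0 [_%:A]mulr1 -/(D h).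
  have -> : - B / A - h^-1 *: D h = - (D h * A + h * B) / (h * A).
    by rewrite (_ : h^-1 *: D h = h^-1 * D h) //; field; rewrite A0 h0.
  rewrite mulNr normrN normrM normfV [`|h * A|]normrM ler_pdivrMr ?mulr_gt0 ?normr_gt0//.
  apply: le_trans Lh _.
  rewrite mulrAC ler_pdivrMr ?ltr_wpDl//.
  rewrite (_ : e * (`|h| * `|A|) * (C + 1) = e * `|A| * (C * `|h| + `|h|)); last by ring.
  by rewrite ler_pM2l ?mulr_gt0// lerD2r.
split; last exact: cvg_lim cvgD.
by apply/cvg_ex; exists (- B / A).
Unshelve. all: by end_near. Qed.

(** * The crossing time *)

Lemma near_lt_continuous (R : realType) (T : topologicalType) (f g : T -> R) (x : T) :
  {for x, continuous f} -> {for x, continuous g} -> f x < g x ->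
  \forall y \near x, f y < g y.
Proof.
move=> cf cg fg.
have cgf : g y - f y @[y --> x] --> g x - f x by exact: (cvgB cg cf).
have /(cvgr_gt _ cgf) : 0 < g x - f x by rewrite subr_gt0.
by apply: filterS => y; rewrite subr_gt0.
Qed.

Lemma continuous_dist (R : realType) (T : topologicalType) (f : T -> R) (x : T) :
  (forall e, 0 < e -> \forall y \near x, `|f x - f y| < e) -> {for x, continuous f}.
Proof. by move=> H; apply/cvgrPdist_lt. Qed.

Section SpiralModel.
Variables (R : realType) (r : nat) (p q k M : R).
Hypotheses (r_gt0 : (0 < r)%N) (p_gt0 : 0 < p) (q_gt0 : 0 < q) (M_gt0 : 0 < M).
(* In the second case [x] and [y ^ r] have the same weight, and [`|k| <= p] makes the
   [k]-term of [denergy3] dominated by the others. *)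
Hypothesis k_cond : k = 0 \/ p = r%:R * q /\ `|k| <= p.
Implicit Types (t : R) (v : 'rV[R]_2).

(* The value at time [- t] of [x ^ 2 + z ^ 2] along the flow
   [(x / M, z) |-> (e ^ (- p t) (x / M + t k z), e ^ (- r q t) z)], where [z = y ^ r]. *)
Definition energy3 t (x z : R) : R :=
  expR (2 * p * t) * (x / M - t * k * z) ^+ 2 + expR (2 * r%:R * q * t) * z ^+ 2.

Definition denergy3 t (x z : R) : R :=
  expR (2 * p * t) * (2 * p * (x / M - t * k * z) ^+ 2 - 2 * k * z * (x / M - t * k * z))
  + expR (2 * r%:R * q * t) * (2 * r%:R * q * z ^+ 2).

Definition energy t v := energy3 t (v 0 0) (v 0 1 ^+ r).
Definition denergy t v := denergy3 t (v 0 0) (v 0 1 ^+ r).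

Lemma is_derive_mull (a t : R) : is_derive t 1 (fun s => a * s) a.
Proof. by apply: is_derive_eq; rewrite -[RHS]mulr1. Qed.

Lemma is_derive_expRZ (a t : R) :
  is_derive t 1 (fun s => expR (a * s)) (a * expR (a * t)).
Proof.
apply: (is_derive_eq (is_derive1_comp (is_derive_expR (a * t)) (is_derive_mull a t))).
by rewrite mulrC.
Qed.

Lemma is_derive_energy3 (x z t : R) :
  is_derive t 1 (fun s => energy3 s x z) (denergy3 t x z).
Proof.
have d1 : is_derive t 1 (fun s : R => x / M - s * k * z) (- (k * z)).
  rewrite (_ : (fun s => _) = fun s => x / M - (k * z) * s); last first.
    by apply/funext => s; ring.
  apply: (is_derive_eq (is_deriveB (is_derive_cst (x / M) t (1 : R)) (is_derive_mull (k * z) t))).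
  by rewrite sub0r.
have d2 := is_deriveM (is_derive_expRZ (2 * p) t) (is_deriveX 2 d1).
have d3 := is_deriveM (is_derive_expRZ (2 * r%:R * q) t) (is_derive_cst (z ^+ 2) t (1 : R)).
rewrite (_ : (fun s => _) = (fun s => expR (2 * p * s)) * (fun s => x / M - s * k * z) ^+ 2
  + (fun s => expR (2 * r%:R * q * s)) * cst (z ^+ 2)); last first.
  by apply/funext => s; rewrite /energy3 !fctE.
apply: (is_derive_eq (is_deriveD d2 d3)).
rewrite /denergy3 /GRing.scale /= /cst !fctE.
by ring.
Qed.

Lemma growth_rate_gt0 : 0 < Num.min p (r%:R * q).
Proof. by rewrite lt_min p_gt0 mulr_gt0// ltr0n. Qed.

(** Without the cross term the rate would be twice the minimum. If [k] is nonzero, [p = r%:R * q]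
    makes the two exponentials equal, and the cross term costs at most [p * (u ^+ 2 + z ^+ 2)] out
    of [2 * p * (u ^+ 2 + z ^+ 2)]. *)
Lemma denergy_ge t v : Num.min p (r%:R * q) * energy t v <= denergy t v.
Proof.
rewrite /energy /denergy /energy3 /denergy3; set z := v 0 1 ^+ r.
set u := v 0 0 / M - _.
have a0 := expR_ge0 (2 * p * t); have b0 := expR_ge0 (2 * r%:R * q * t).
have u0 := sqr_ge0 u; have z0 := sqr_ge0 z.
have rq0 : 0 < r%:R * q by rewrite mulr_gt0// ltr0n.
have cp : Num.min p (r%:R * q) <= p by rewrite ge_min lexx.
have cq : Num.min p (r%:R * q) <= r%:R * q by rewrite ge_min lexx orbT.
move: growth_rate_gt0 cp cq; set c := Num.min _ _ => c0 cp cq.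
have au : 0 <= expR (2 * p * t) * u ^+ 2 by rewrite mulr_ge0.
have bz : 0 <= expR (2 * r%:R * q * t) * z ^+ 2 by rewrite mulr_ge0.
have h1 := ler_wpM2r au cp; have h2 := ler_wpM2r bz cq.
have h3 := mulr_ge0 (ltW p_gt0) au; have h4 := mulr_ge0 (ltW rq0) bz.
case: k_cond => [k0|[pE kp]].
  by rewrite k0 !(mulr0, mul0r) subr0; clear -h1 h2 h3 h4; nra.
have bE : expR (2 * r%:R * q * t) = expR (2 * p * t) by rewrite pE !mulrA.
have kuz : 2 * k * z * u <= p * (u ^+ 2 + z ^+ 2).
  have : 2 * k * z * u <= `|k| * (u ^+ 2 + z ^+ 2).
    have H1 := sqr_ge0 (u - z); have H2 := sqr_ge0 (u + z).
    clear -H1 H2; by case: (ler0P k) => k0; nra.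
  by move=> /le_trans; apply; rewrite ler_wpM2r// addr_ge0.
have h5 := ler_wpM2l a0 kuz.
rewrite bE -[2 * r%:R * q]mulrA -pE in h2 h4 *.
by clear -h1 h2 h3 h4 h5; nra.
Qed.

Lemma row2_eq0 v : (v == 0) = (v 0 0 == 0) && (v 0 1 == 0).
Proof.
apply/eqP/andP => [->|[/eqP v0 /eqP v1]]; first by rewrite !mxE.
apply/rowP => i; rewrite mxE; case: i => -[|[|//]] hi.
  by rewrite -v0; congr (v _ _); apply: val_inj.
by rewrite -v1; congr (v _ _); apply: val_inj.
Qed.

Lemma energy_gt0 v t : v != 0 -> 0 < energy t v.
Proof.
rewrite row2_eq0 negb_and /energy /energy3.
have [->|y0] := eqVneq (v 0 1) 0.
  rewrite orbF => x0; rewrite expr0n (gtn_eqF r_gt0)/= !mulr0 subr0 expr0n/= mulr0 addr0.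
  by rewrite mulr_gt0 ?expR_gt0// exprn_even_gt0//= mulf_neq0// invr_neq0// gt_eqF.
move=> _; rewrite ltr_wpDl//; first by rewrite mulr_ge0 ?expR_ge0 ?sqr_ge0.
by rewrite mulr_gt0 ?expR_gt0// exprn_even_gt0//= expf_neq0.
Qed.

(* Unspecified at [v = 0], where the energy vanishes identically. *)
Definition time v : R := get [set t | energy t v = 1].

Lemma energy_lt v s t : v != 0 -> s < t -> energy s v < energy t v.
Proof.
move=> v0; exact: (growth_lt growth_rate_gt0 (fun t => energy_gt0 t v0)
  (fun t => is_derive_energy3 _ _ t) (denergy_ge ^~ v)).
Qed.

Lemma energy_time v : v != 0 -> energy (time v) v = 1.
Proof.
move=> v0; have [t tE] := growth_eq1 growth_rate_gt0 (fun t => energy_gt0 t v0)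
  (fun t => is_derive_energy3 _ _ t) (denergy_ge ^~ v).
by rewrite /time; case: xgetP => [_ -> //|/(_ t)].
Qed.

Lemma time_unique v t : v != 0 -> energy t v = 1 -> time v = t.
Proof.
move=> v0 tE; have TE := energy_time v0.
have [lt|gt|//] := ltgtP (time v) t.
  by have := energy_lt v0 lt; rewrite tE TE ltxx.
by have := energy_lt v0 gt; rewrite tE TE ltxx.
Qed.

Definition punctured_plane : set 'rV[R]_2 := [set v | v != 0].

Lemma open_punctured_plane : open punctured_plane.
Proof.
have -> : punctured_plane = ~` [set 0] by apply/seteqP; split => v /= /eqP.
by rewrite openC; exact: (accessible_closed_set1 (hausdorff_accessible (@norm_hausdorff _ _))).
Qed.

Lemma Ck_energy n t : Ck_on n setT (energy t).
Proof.
have oT : open [set: 'rV[R]_2] := openT.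
rewrite /energy /energy3; apply: CkD => //; apply: CkM => //; try exact: Ck_cst.
- apply: CkX => //; apply: CkB => //; last by apply: CkZ => //; apply: CkX => //; exact: Ck_coord.
  by apply: CkM => //; [exact: Ck_coord|exact: Ck_cst].
- by apply: CkX => //; apply: CkX => //; exact: Ck_coord.
Qed.

(** The energies of [v] at times [time v - e] and [time v + e] lie strictly on either side of 1. At
    these two fixed times the energy is continuous in the point, so the inequalities persist nearby,
    and monotonicity in time traps the crossing between them. *)
Lemma continuous_time v : v != 0 -> {for v, continuous time}.
Proof.
move=> v0; apply: continuous_dist => e e0.
have cE t : {for v, continuous (energy t)} by exact: (Ck_cont (Ck_energy 0 t)).
have TE := energy_time v0.
have Elo : energy (time v - e) v < 1.
  by rewrite -[ltRHS]TE energy_lt// ltrBlDr ltrDl.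
have Ehi : 1 < energy (time v + e) v.
  by rewrite -[ltLHS]TE energy_lt// ltrDl.
near=> w.
have w0 : w != 0 by near: w; exact: open_nbhs_nbhs (conj open_punctured_plane v0).
have wlo : energy (time v - e) w < 1.
  by near: w; exact: (@near_lt_continuous _ _ _ (cst 1) v (cE _) (@cst_continuous _ _ _ _) Elo).
have whi : 1 < energy (time v + e) w.
  by near: w; exact: (@near_lt_continuous _ _ (cst 1) _ v (@cst_continuous _ _ _ _) (cE _) Ehi).
have wT := energy_time w0.
have lo : time v - e < time w.
  rewrite ltNge le_eqVlt; apply/negP => /orP[/eqP wE|/(energy_lt w0) lt].
    by move: wlo; rewrite -wE wT ltxx.
  by have := lt_trans lt wlo; rewrite wT ltxx.
have hi : time w < time v + e.
  rewrite ltNge le_eqVlt; apply/negP => /orP[/eqP wE|/(energy_lt w0) lt].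
    by move: whi; rewrite wE wT ltxx.
  by have := lt_trans whi lt; rewrite wT ltxx.
by rewrite ltr_norml; apply/andP; split; lra.
Unshelve. all: by end_near. Qed.

End SpiralModel.

(** * Smoothness of the crossing time *)

Lemma differentiable_pow (R : realType) (V : normedModType R) (f : V -> R) n (x : V) :
  differentiable (f : _ -> R^o) x -> differentiable ((fun y => f y ^+ n) : _ -> R^o) x.
Proof.
move=> df; rewrite (_ : (fun y => _) = f ^+ n); last by apply/funext => y; rewrite fctE.
by case: n => [|n]; [exact: differentiable_cst|exact: differentiableX].
Qed.

Section SpiralTimeSmooth.
Variables (R : realType) (r : nat) (p q k M : R).
Hypotheses (r_gt0 : (0 < r)%N) (p_gt0 : 0 < p) (q_gt0 : 0 < q) (M_gt0 : 0 < M).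
Hypothesis k_cond : k = 0 \/ p = r%:R * q /\ `|k| <= p.
Implicit Types (t : R) (v w : 'rV[R]_2).

Local Notation energy := (energy r p q k M).
Local Notation denergy := (denergy r p q k M).
Local Notation time := (time r p q k M).

(** The derivative of [energy t] at [v] in the direction [w], as a formula to which the closure
    properties of C^n functions apply. *)
Definition energy_dir t v w : R :=
  expR (2 * p * t) * (2 * (v 0 0 / M - t * k * v 0 1 ^+ r) *
    (w 0 0 / M - t * k * (r%:R * v 0 1 ^+ r.-1 * w 0 1)))
  + expR (2 * r%:R * q * t) * (2 * v 0 1 ^+ r * (r%:R * v 0 1 ^+ r.-1 * w 0 1)).

Lemma differentiable_fst (c : R * R) : differentiable (fst : R * R -> R^o) c.
Proof. by apply: linear_differentiable => x; exact: cvg_fst. Qed.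

Lemma differentiable_snd (c : R * R) : differentiable (snd : R * R -> R^o) c.
Proof. by apply: linear_differentiable => x; exact: cvg_snd. Qed.

Lemma is_derive_line (a b h : R) : is_derive h 1 (fun s : R => s * a + b) a.
Proof.
rewrite (_ : (fun s => _) = (fun s => a * s) + cst b); last first.
  by apply/funext => s; rewrite !fctE mulrC.
apply: (is_derive_eq (is_deriveD (is_derive_mull a h) (is_derive_cst b h (1 : R)))).
by rewrite addr0.
Qed.

Lemma is_derive_energy_dir t v w :
  is_derive (0 : R) 1 (fun h => energy t (h *: w + v)) (energy_dir t v w).
Proof.
pose x := v 0 0; pose y := v 0 1; pose dx := w 0 0; pose dy := w 0 1.
have dX := is_derive_line dx x (0 : R).
have dY := is_deriveX r (is_derive_line dy y (0 : R)).
have dU := is_deriveB (is_deriveM dX (is_derive_cst M^-1 (0 : R) (1 : R)))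
                      (is_deriveZ (t * k) dY).
have dE := is_deriveD (is_deriveZ (expR (2 * p * t)) (is_deriveX 2 dU))
                      (is_deriveZ (expR (2 * r%:R * q * t)) (is_deriveX 2 dY)).
move: dE; set F := (X in is_derive _ _ X _ -> _).
rewrite (_ : (fun h => energy t (h *: w + v)) = F); last first.
  by apply/funext => h; rewrite /F /energy /energy3 !mxE !fctE.
move=> dE; apply: (is_derive_eq dE).
rewrite /energy_dir /GRing.scale/= !fctE /cst !mul0r !add0r.
rewrite (_ : ((t * k) \*: _) 0 = t * k * y ^+ r); last first.
  by rewrite -[LHS]/(t * k * (0 * dy + y) ^+ r) mul0r add0r.
by rewrite !expr1 -/x -/y -/dx -/dy; ring.
Qed.

Lemma differentiable_energy_line v w (c : R * R) :
  differentiable ((fun a : R * R => energy a.1 (a.2 *: w + v)) : _ -> R^o) c.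
Proof.
have d1 := differentiable_fst c; have d2 := differentiable_snd c.
have dexp a : differentiable ((fun b : R * R => expR (a * b.1)) : _ -> R^o) c.
  apply: (@differentiable_comp _ _ _ _ (fun b : R * R => a * b.1 : R^o) (expR : R^o -> R^o)).
    exact: differentiableZ.
  by apply/derivable1_diffP; exact: derivable_expR.
have dX : differentiable ((fun b : R * R => b.2 * w 0 0 + v 0 0) : _ -> R^o) c.
  apply: differentiableD; last exact: differentiable_cst.
  by apply: differentiableM => //; exact: differentiable_cst.
have dY : differentiable ((fun b : R * R => (b.2 * w 0 1 + v 0 1) ^+ r) : _ -> R^o) c.
  apply: differentiable_pow; apply: differentiableD; last exact: differentiable_cst.
  by apply: differentiableM => //; exact: differentiable_cst.
rewrite (_ : (fun a => _) = (fun a : R * R => expR (2 * p * a.1) *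
   ((a.2 * w 0 0 + v 0 0) / M - a.1 * k * (a.2 * w 0 1 + v 0 1) ^+ r) ^+ 2
   + expR (2 * r%:R * q * a.1) * ((a.2 * w 0 1 + v 0 1) ^+ r) ^+ 2)); last first.
  by apply/funext => a; rewrite /energy /energy3 !mxE.
apply: differentiableD; apply: differentiableM => //; apply: differentiable_pow => //.
apply: differentiableB; apply: differentiableM => //.
exact: differentiableM.
Qed.

Lemma denergy_neq0 v t : v != 0 -> denergy t v != 0.
Proof.
move=> v0; rewrite gt_eqF//; apply: lt_le_trans (denergy_ge M r_gt0 p_gt0 q_gt0 k_cond t v).
by rewrite mulr_gt0 ?growth_rate_gt0// energy_gt0.
Qed.

(** Implicit differentiation of [energy (time v) v = 1] along the line [h *: w + v]. *)
Lemma is_derive_time v w : v != 0 ->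
  is_derive v w (time : _ -> R^o) (- energy_dir (time v) v w / denergy (time v) v).
Proof.
move=> v0.
pose tau h := time (h *: w + v).
have tau0 : tau 0 = time v by rewrite /tau scale0r add0r.
have cline : {for 0, continuous (fun h : R => h *: w + v)}.
  by apply: continuousD; [exact: scalel_continuous|exact: cst_continuous].
have ctau : {for 0, continuous tau}.
  apply: (@continuous_comp _ _ _ (fun h : R => h *: w + v) time 0 cline).
  by rewrite scale0r add0r; exact: continuous_time.
have near0 : \forall h \near (0 : R), h *: w + v != 0.
  have /cline // : nbhs (0 *: w + v) (@punctured_plane R).
  rewrite scale0r add0r; exact: open_nbhs_nbhs (conj (@open_punctured_plane R) v0).
have := @is_derive_implicit R (fun a => energy a.1 (a.2 *: w + v)) tau
  (denergy (time v) v) (energy_dir (time v) v w) ctau.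
rewrite tau0 => H.
have [] : is_derive (0 : R) 1 tau (- energy_dir (time v) v w / denergy (time v) v).
  apply: H.
  - apply: filterS near0 => h h0 /=.
    by rewrite scale0r add0r !energy_time.
  - exact: differentiable_energy_line.
  - rewrite /= scale0r add0r; exact: is_derive_energy3.
  - exact: is_derive_energy_dir.
  - exact: denergy_neq0.
move=> d1 d2; split; first exact/derivable1P.
rewrite -d2 /derive; set g1 := fun t => t^-1 *: _; set g2 := fun t => t^-1 *: _.
suff -> : g1 = g2 by [].
by apply/funext => t; rewrite /g1 /g2 /tau /= addr0 scale0r add0r [_%:A]mulr1.
Qed.

(** Bootstrapping: the formula for the derivative is built from coordinates, exponentials and [time]
    itself, so it is C^n as soon as [time] is. *)
Lemma Ck_time n : Ck_on n (@punctured_plane R) time.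
Proof.
have oV := @open_punctured_plane R.
have cT v : punctured_plane v -> {for v, continuous time}.
  by move=> v0; exact: continuous_time.
elim: n => [|n IH]; first by [].
apply: (CkS_intro (G := fun i v => - energy_dir (time v) v (delta_mx 0 i)
  / denergy (time v) v) oV cT) => [v v0 i|i]; first exact: is_derive_time.
have Cx := Ck_coord n (0 : 'I_2) oV; have Cy := Ck_coord n (1 : 'I_2) oV.
have Cc a : Ck_on n (@punctured_plane R) (fun=> a) by exact: Ck_cst.
have Cexp a : Ck_on n (@punctured_plane R) (fun v => expR (a * time v)).
  by apply: Ck_expR => //; exact: CkZ.
have Cyr m : Ck_on n (@punctured_plane R) (fun v => v 0 1 ^+ m) by exact: CkX.
have Cu : Ck_on n (@punctured_plane R) (fun v => v 0 0 / M - time v * k * v 0 1 ^+ r).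
  by apply: CkB => //; apply: CkM => //; exact: CkM.
apply: CkM => //.
  apply: CkN => //; apply: CkD => //; apply: CkM => //; apply: CkM => //.
  - by apply: CkZ.
  - apply: CkB => //; apply: CkM => //; first exact: CkM.
    by apply: CkM => //; exact: CkZ.
  - exact: CkZ.
  - by apply: CkM => //; exact: CkZ.
apply: Ck_inv => //; first by move=> v v0; exact: denergy_neq0.
apply: CkD => //; apply: CkM => //.
- apply: CkB => //; first by apply: CkZ => //; exact: CkX.
  by apply: CkM => //; exact: CkM.
- by apply: CkM => //; exact: CkX.
Qed.

End SpiralTimeSmooth.

(** * Angle and time coordinates *)

Section Angle.
Variable R : realType.
Implicit Types (s x c d : R) (m : int).

Lemma cos_sin_turn s m :
  cos (2 * pi * (s + m%:~R)) = cos (2 * pi * s) /\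
  sin (2 * pi * (s + m%:~R)) = sin (2 * pi * s).
Proof.
have N (u : R) n : cos (2 * pi * (u + n%:R)) = cos (2 * pi * u) /\
             sin (2 * pi * (u + n%:R)) = sin (2 * pi * u).
  have -> : 2 * pi * (u + n%:R) = 2 * pi * u + (pi *+ 2) *+ n :> R.
    by rewrite -[(pi *+ 2) *+ n]mulr_natr -[pi *+ 2]mulr_natr; ring.
  by rewrite (periodicn (@cosD2pi R)) (periodicn (@sinD2pi R)).
case: m => n; first exact: N.
have := N (s - n.+1%:R) n.+1; rewrite subrK NegzE mulrNz pmulrn => -[-> ->].
by [].
Qed.

(** Subtracting the floor leaves [u] in [0, 1). Cosine is injective on [0, pi], which settles
    [u <= 1 / 2]; the reflection [1 - u] brings the other half there, and would give [u = 1]. *)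
Lemma turn_of_cos1 s : cos (2 * pi * s) = 1 -> exists m, s = m%:~R.
Proof.
move=> cs; exists (Num.floor s).
have /andP[fl fu] := real_floor_itv (num_real s).
pose u := s - (Num.floor s)%:~R.
suff : u = 0 by move=> /eqP; rewrite subr_eq0 => /eqP.
have cu : cos (2 * pi * u) = 1.
  by have [<- _] := cos_sin_turn u (Num.floor s); rewrite subrK.
have u0 : 0 <= u by rewrite subr_ge0.
have u1 : u < 1 by rewrite ltrBlDr addrC; move: fu; rewrite intrD.
have pi0 := pi_gt0 R.
have inj (x : R) : 0 <= x <= 1 / 2 -> cos (2 * pi * x) = 1 -> x = 0.
  move=> /andP[x0 x1] cx.
  have : 2 * pi * x = 0.
    apply: (@cos_inj R); last by rewrite cos0.
      by rewrite in_itv/=; apply/andP; split; nra.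
    by rewrite in_itv/= lexx ltW.
  by move/eqP; rewrite mulf_eq0 mulf_eq0 (gt_eqF pi0) pnatr_eq0/= => /eqP.
have [uh|uh] := leP u (1 / 2); first by apply: inj; rewrite ?u0.
have : 1 - u = 0.
  apply: inj; first by apply/andP; split; lra.
  have [] := cos_sin_turn (- u) 1; rewrite mulr1z addrC => -> _.
  by rewrite mulrN cosN.
lra.
Qed.

(** The hypotheses turn the cosine of the difference of the angles into cos^2 + sin^2 = 1. *)
Lemma turn_of_cos_sin (x y : R) : cos (2 * pi * x) = cos (2 * pi * y) ->
  sin (2 * pi * x) = sin (2 * pi * y) -> exists m, x = y + m%:~R.
Proof.
move=> ce se; have [|m mE] := @turn_of_cos1 (x - y).
  by rewrite mulrBr cosB ce se -!expr2 cos2Dsin2.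
by exists m; rewrite -mE addrC subrK.
Qed.

Lemma ex_angle c d : c ^+ 2 + d ^+ 2 = 1 ->
  exists s, cos (2 * pi * s) = c /\ sin (2 * pi * s) = d.
Proof.
move=> cd.
have c1 : -1 <= c <= 1 by have d0 := sqr_ge0 d; apply/andP; split; nra.
have pi0 := pi_gt0 R.
have dE : Num.sqrt (1 - c ^+ 2) = `|d|.
  by rewrite (_ : 1 - c ^+ 2 = d ^+ 2) ?sqrtr_sqr -?cd//; ring.
have H : forall x : R, 2 * pi * (x / (2 * pi)) = x.
  by move=> x; rewrite mulrCA divff ?mulr1// mulf_neq0// gt_eqF.
have ac : cos (acos c) = c by rewrite acosK// in_itv.
have [d0|d0] := lerP 0 d.
  exists (acos c / (2 * pi)); rewrite H; split; first exact: ac.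
  by rewrite sin_acos// dE ger0_norm.
exists (- (acos c) / (2 * pi)); rewrite H cosN sinN; split; first exact: ac.
by rewrite sin_acos// dE ltr0_norm// opprK.
Qed.

Lemma cos_sin_atan c d : c ^+ 2 + d ^+ 2 = 1 -> 0 < c ->
  cos (atan (d / c)) = c /\ sin (atan (d / c)) = d.
Proof.
move=> cd c0.
have cE : cos (atan (d / c)) = c.
  rewrite cos_atan (_ : 1 + (d / c) ^+ 2 = c ^- 2); last first.
    rewrite -[1 in LHS](divff (lt0r_neq0 (exprn_gt0 2 c0))) expr_div_n -mulrDl cd.
    by rewrite mul1r.
  by rewrite -exprVn sqrtr_sqr ger0_norm ?invr_ge0 ?ltW// invrK.
split => //; have := atanK (d / c); rewrite /tan cE => /(congr1 (fun x => x * c)).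
by rewrite !divfK ?gt_eqF.
Qed.

End Angle.

Lemma vec2_0 (R : realType) (x y : R) : vec2 x y 0 0 = x.
Proof. by rewrite mxE. Qed.

Lemma vec2_1 (R : realType) (x y : R) : vec2 x y 0 1 = y.
Proof. by rewrite mxE. Qed.

Lemma vec2_eta (R : realType) (v : 'rV[R]_2) : vec2 (v 0 0) (v 0 1) = v.
Proof.
apply/rowP => i; rewrite mxE; case: i => -[|[|//]] hi /=.
  by congr (v _ _); apply: val_inj.
by congr (v _ _); apply: val_inj.
Qed.

Section Spiral.
Variables (R : realType) (r : nat) (p q k M : R).
Hypotheses (r_gt0 : (0 < r)%N) (p_gt0 : 0 < p) (q_gt0 : 0 < q) (M_gt0 : 0 < M).
Hypothesis k_cond : k = 0 \/ p = r%:R * q /\ `|k| <= p.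
Implicit Types (s t y : R) (v w : 'rV[R]_2).

Local Notation energy := (energy r p q k M).
Local Notation time := (time r p q k M).
Local Notation V := (@punctured_plane R).

(* [(1 - y ^ 2) * profile y = 1 - y ^ (2 r)], so that [x ^ 2 + y ^ (2 r) = 1] is
   parametrized by [x = cos a * sqrt (profile (sin a))], [y = sin a]. *)
Definition profile y : R := \sum_(i < r) (y ^+ 2) ^+ i.

Lemma profile_gt0 y : 0 < profile y.
Proof.
rewrite /profile; case: r r_gt0 => // r' _; rewrite big_ord_recl expr0 ltr_wpDr//.
by apply: sumr_ge0 => i _; rewrite exprn_ge0// sqr_ge0.
Qed.

Lemma profileE c y : c ^+ 2 + y ^+ 2 = 1 -> c ^+ 2 * profile y + (y ^+ r) ^+ 2 = 1.
Proof.
move=> cy; have := subrX1 (y ^+ 2) r; rewrite -/(profile y) -exprM mulnC exprM => pE.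
rewrite (_ : c ^+ 2 = - (y ^+ 2 - 1)); last by rewrite -cy; ring.
by rewrite mulNr -pE; ring.
Qed.

(** The flow at time [t] of the curve point at angle [2 * pi * s], after which [M] undoes the
    rescaling of the first coordinate. *)
Definition spiral s t : 'rV[R]_2 :=
  vec2 (M * expR (- p * t) *
          (cos (2 * pi * s) * Num.sqrt (profile (sin (2 * pi * s)))
           + t * k * sin (2 * pi * s) ^+ r))
       (expR (- q * t) * sin (2 * pi * s)).

(** Homogeneity of the shear: y^r has the weight of x whenever [k] is nonzero. The factor [k] on
    both sides lets one equation cover the diagonal case too. *)
Lemma k_expR t : k * expR (q * t) ^+ r = k * expR (p * t).
Proof.
case: k_cond => [->|[-> _]]; first by rewrite !mul0r.
by rewrite -expRM_natl mulrA.
Qed.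

Lemma energy_spiral s t : energy t (spiral s t) = 1.
Proof.
rewrite /energy /energy3 vec2_0 vec2_1; set c := cos _; set y := sin _.
have MN0 : M != 0 by rewrite gt_eqF.
have ke := k_expR (- t); rewrite !mulrN -!mulNr in ke.
rewrite exprMn.
rewrite (_ : _ / M - _ = expR (- p * t) * (c * Num.sqrt (profile y))); last first.
  rewrite (_ : t * k * (expR (- q * t) ^+ r * y ^+ r) =
    t * (k * expR (- q * t) ^+ r) * y ^+ r); last by ring.
  by rewrite ke; field.
rewrite exprMn mulrA -expRM_natl -expRD (_ : 2 * p * t + _ = 0); last by ring.
rewrite expR0 mul1r [(_ ^+ r * _) ^+ 2]exprMn mulrA -!expRM_natl -expRD.
rewrite (_ : 2 * r%:R * q * t + _ = 0); last by ring.
rewrite expR0 mul1r exprMn sqr_sqrtr ?ltW ?profile_gt0//.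
by apply: profileE; rewrite cos2Dsin2.
Qed.

Lemma spiral_neq0 s t : spiral s t != 0.
Proof.
apply/eqP => s0; have := energy_spiral s t.
rewrite s0 /energy /energy3 !mxE expr0n gtn_eqF//= mulr0 mul0r subr0 expr0n/= !mulr0 addr0.
by move=> /eqP; rewrite eq_sym oner_eq0.
Qed.

Lemma time_spiral s t : time (spiral s t) = t.
Proof.
by apply: time_unique => //; [exact: spiral_neq0|exact: energy_spiral].
Qed.

(** [circle_sin] and [circle_cos] are the sine and cosine of the angle of [v]: [v] is carried back
    to the curve by the flow, where the parametrization through [profile] is inverted. *)
Definition circle_sin v : R := expR (q * time v) * v 0 1.
Definition circle_cos v : R :=
  expR (p * time v) * (v 0 0 / M - time v * k * v 0 1 ^+ r)
  / Num.sqrt (profile (circle_sin v)).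

Lemma sqrt_profile_gt0 y : 0 < Num.sqrt (profile y).
Proof. by rewrite sqrtr_gt0 profile_gt0. Qed.

Lemma circle_cos_sin v : v != 0 -> circle_cos v ^+ 2 + circle_sin v ^+ 2 = 1.
Proof.
move=> v0; have := energy_time r_gt0 p_gt0 q_gt0 M_gt0 k_cond v0.
rewrite /energy /energy3 => eE.
have pos := profile_gt0 (circle_sin v).
rewrite /circle_cos expr_div_n sqr_sqrtr ?ltW// exprMn -expRM_natl mulrA.
move: eE; set A := expR _ * _ ^+ 2; set B := _ * _ ^+ 2 => eE.
have BE : B = (circle_sin v ^+ 2) ^+ r.
  rewrite /B /circle_sin !exprMn -!expRM_natl.
  rewrite (_ : 2 * r%:R * q * time v = r%:R * (q * time v) + r%:R * (q * time v)).
    by rewrite expRD; ring.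
  by ring.
have := subrX1 (circle_sin v ^+ 2) r; rewrite -/(profile _) -BE => pE.
rewrite (_ : A = - (B - 1)); last by rewrite -eE; ring.
by rewrite pE -mulNr mulfK ?gt_eqF//; ring.
Qed.

Lemma spiral_circle v s : v != 0 ->
  cos (2 * pi * s) = circle_cos v -> sin (2 * pi * s) = circle_sin v ->
  spiral s (time v) = v.
Proof.
move=> v0 cE sE; rewrite /spiral cE sE /circle_cos divfK ?gt_eqF ?sqrt_profile_gt0//.
rewrite /circle_sin; set t := time v; rewrite -[RHS]vec2_eta; congr vec2.
  rewrite exprMn (_ : t * k * (_ * _) = t * (k * expR (q * t) ^+ r) * v 0 1 ^+ r); last by ring.
  rewrite k_expR mulNr expRN; field.
  by rewrite !gt_eqF ?expR_gt0.
by rewrite mulrA -expRD mulNr addNr expR0 mul1r.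
Qed.

Lemma circle_sin_spiral s t : circle_sin (spiral s t) = sin (2 * pi * s).
Proof.
by rewrite /circle_sin time_spiral vec2_1 mulrA -expRD mulNr subrr expR0 mul1r.
Qed.

Lemma circle_cos_spiral s t : circle_cos (spiral s t) = cos (2 * pi * s).
Proof.
rewrite /circle_cos circle_sin_spiral time_spiral vec2_0 vec2_1.
set c := cos _; set y := sin _; set S := Num.sqrt _.
have ke := k_expR (- t); rewrite !mulrN -!mulNr in ke.
rewrite exprMn (_ : t * k * (expR (- q * t) ^+ r * y ^+ r) =
    t * (k * expR (- q * t) ^+ r) * y ^+ r); last by ring.
rewrite ke mulNr expRN; field.
by rewrite !gt_eqF ?expR_gt0 ?sqrt_profile_gt0.
Qed.

Lemma spiral_turn s t (m : int) : spiral (s + m%:~R) t = spiral s t.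
Proof. by rewrite /spiral; have [-> ->] := cos_sin_turn s m. Qed.

Lemma spiral_inj s t s' t' : spiral s t = spiral s' t' ->
  t = t' /\ exists m : int, s = s' + m%:~R.
Proof.
move=> e; split; first by rewrite -(time_spiral s t) e time_spiral.
by apply: turn_of_cos_sin;
  rewrite -?(circle_cos_spiral _ t) -?(circle_sin_spiral _ t) e
    ?circle_cos_spiral ?circle_sin_spiral.
Qed.

Lemma spiral_surj v : v != 0 -> exists s, spiral s (time v) = v.
Proof.
move=> v0; have [s [cE sE]] := ex_angle (circle_cos_sin v0).
by exists s; exact: spiral_circle.
Qed.

Lemma Ck_profile n (m : nat) (U : set 'rV[R]_m) (g : 'rV[R]_m -> R) : open U ->
  Ck_on n U g -> Ck_on n U (fun x => profile (g x)).
Proof. by move=> oU Cg; apply: Ck_sum => // i; apply: CkX => //; exact: CkX. Qed.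

Lemma Ck_circle n : Ck_on n V circle_cos /\ Ck_on n V circle_sin.
Proof.
have oV := @open_punctured_plane R.
have CT : Ck_on n V time by exact: Ck_time.
have Cx := Ck_coord n (0 : 'I_2) oV; have Cy := Ck_coord n (1 : 'I_2) oV.
have Cs : Ck_on n V circle_sin.
  by apply: CkM => //; apply: Ck_expR => //; exact: CkZ.
split=> //; apply: CkM => //.
  apply: CkM => //; first by apply: Ck_expR => //; exact: CkZ.
  apply: CkB => //; apply: CkM => //; [exact: Ck_cst| |exact: CkX].
  by apply: CkM => //; exact: Ck_cst.
apply: Ck_inv => //; first by move=> v _; rewrite gt_eqF// sqrt_profile_gt0.
by apply: Ck_sqrt => //; [move=> v _; exact: profile_gt0|exact: Ck_profile].
Qed.

(** [C] and [D] are the cosine and sine of the angle of [v] measured from that of the base point. On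
    the half where [C] is positive, the arctangent of [D / C] is a smooth branch of this angle. *)
Lemma spiral_local_section s0 t0 : exists (A : set 'rV[R]_2) (sigma : 'rV[R]_2 -> R),
  [/\ open A, A (spiral s0 t0), A `<=` V, forall n, Ck_on n A sigma &
      sigma (spiral s0 t0) = s0 /\ forall v, A v -> spiral (sigma v) (time v) = v].
Proof.
set v0 := spiral s0 t0; set c0 := cos (2 * pi * s0); set d0 := sin (2 * pi * s0).
have oV := @open_punctured_plane R.
pose C v := circle_cos v * c0 + circle_sin v * d0.
pose D v := circle_sin v * c0 - circle_cos v * d0.
have CC n : Ck_on n V C.
  by have [? ?] := Ck_circle n; apply: CkD => //; apply: CkM => //; exact: Ck_cst.
have CD n : Ck_on n V D.
  by have [? ?] := Ck_circle n; apply: CkB => //; apply: CkM => //; exact: Ck_cst.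
have cd0 : c0 ^+ 2 + d0 ^+ 2 = 1 by rewrite cos2Dsin2.
pose A := V `&` [set v | 0 < C v].
have oA : open A.
  rewrite openE => v [Vv Cv]; apply: filterI; first exact: open_nbhs_nbhs.
  exact: (@near_lt_continuous _ _ (cst 0) C v (@cst_continuous _ _ _ _)
    (Ck_cont (CC 0) Vv) Cv).
have AV : A `<=` V by move=> v [].
have C0 : C v0 = 1 by rewrite /C circle_cos_spiral circle_sin_spiral -!expr2.
have D0 : D v0 = 0 by rewrite /D circle_cos_spiral circle_sin_spiral mulrC subrr.
exists A, (fun v => s0 + atan (D v / C v) / (2 * pi)); split => //.
- by split; [exact: spiral_neq0|rewrite /= C0 ltr01].
- move=> n; apply: CkD => //; first exact: Ck_cst.
  apply: CkM => //; last exact: Ck_cst.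
  apply: Ck_atan => //; apply: CkM => //; first exact: (Ck_sub AV).
  apply: Ck_inv => //; last exact: (Ck_sub AV).
  by move=> v [_ /= Cv]; rewrite gt_eqF.
- split; first by rewrite D0 mul0r atan0 mul0r addr0.
  move=> v [Vv /= Cv]; have cs := circle_cos_sin Vv.
  have CD1 : C v ^+ 2 + D v ^+ 2 = 1.
    transitivity ((circle_cos v ^+ 2 + circle_sin v ^+ 2) * (c0 ^+ 2 + d0 ^+ 2)).
      by rewrite /C /D; ring.
    by rewrite cs cd0 mulr1.
  have [ca sa] := cos_sin_atan CD1 Cv.
  have aE : 2 * pi * (s0 + atan (D v / C v) / (2 * pi)) = 2 * pi * s0 + atan (D v / C v).
    by rewrite mulrDr [_ * (_ / _)]mulrCA divff ?mulr1// mulf_neq0// gt_eqF ?pi_gt0.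
  apply: spiral_circle => //; rewrite aE.
    rewrite cosD ca sa -/c0 -/d0 -[RHS]mulr1 -cd0 /C /D; ring.
  rewrite sinD ca sa -/c0 -/d0 -[RHS]mulr1 -cd0 /C /D; ring.
Qed.

End Spiral.

(** * Orbit spaces *)

Lemma continuous_row (R : realType) (T : topologicalType) n (F : T -> 'rV[R]_n) (x : T) :
  (forall j, {for x, continuous (fun y => F y 0 j)}) -> {for x, continuous F}.
Proof.
move=> cF A [I nI IA]; apply: filterS IA _.
have : \forall y \near x, forall j, I 0 j (F y 0 j).
  by apply: filter_forall => j; apply: cF; exact: nI.
by apply: filterS => y yI i j; rewrite ord1.
Qed.

Lemma open_preimage_in (S T : topologicalType) (A : set S) (B : set T) (g : S -> T) :
  open A -> open B -> (forall x, A x -> {for x, continuous g}) -> open (A `&` g @^-1` B).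
Proof.
move=> oA oB cg; rewrite openE => x [Ax Bx]; apply: filterI; first exact: open_nbhs_nbhs.
by apply: (cg x Ax); exact: open_nbhs_nbhs.
Qed.

Lemma Cinfty_continuous (R : realType) m n (A : set 'rV[R]_m) (F : 'rV[R]_m -> 'rV[R]_n) :
  Cinfty_on A F -> forall x, A x -> {for x, continuous F}.
Proof. move=> CF x Ax; apply: continuous_row => j.
exact: (Ck_cont (CF j 0%N) Ax). Qed.

(** Since [s] is injective, the selection sends each basis vector to a basis vector or to 0. Each
    partial derivative of the pullback is therefore the pullback of a partial derivative of [g], or
    0, and the induction closes. *)
Lemma Ck_select (R : realType) m n k (s : 'I_n -> 'I_m) (A : set 'rV[R]_n) (g : 'rV[R]_n -> R) :
    injective s -> open A -> Ck_on k A g ->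
  Ck_on k [set x : 'rV[R]_m | A (\row_j x 0 (s j))] (fun x => g (\row_j x 0 (s j))).
Proof.
move=> s_inj oA; pose sel (x : 'rV[R]_m) : 'rV[R]_n := \row_j x 0 (s j).
have csel x : {for x, continuous sel}.
  apply: continuous_row => j.
  have -> : (fun y => sel y 0 j) = fun y : 'rV[R]_m => y 0 (s j).
    by apply/funext => y; rewrite mxE.
  exact: coord_continuous.
have oS : open [set x | A (sel x)].
  have := open_preimage_in openT oA (fun x _ => csel x).
  by rewrite setTI.
have cg (h : 'rV[R]_n -> R) : (forall x, A x -> {for x, continuous h}) ->
    forall x, A (sel x) -> {for x, continuous (h \o sel)}.
  by move=> ch x Ax; apply: continuous_comp; [exact: csel|exact: ch].
elim: k g => [|k IH] g Cg; first by split => //; exact: cg (fun x Ax => Ck_cont Cg Ax).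
have [dg Cdg] := CkS_elim Cg.
have selD t w x : sel (t *: w + x) = t *: sel w + sel x by apply/rowP => j; rewrite !mxE.
pose G i (x : 'rV[R]_m) : R := 'D_(sel (delta_mx 0 i)) (g : _ -> R^o) (sel x).
have dsel i : (exists j, s j = i /\ sel (delta_mx 0 i) = delta_mx 0 j) \/ sel (delta_mx 0 i) = 0.
  have [[j jE]|nj] := pselect (exists j, s j = i).
    left; exists j; split => //; apply/rowP => l; rewrite !mxE -jE (inj_eq s_inj).
    by [].
  right; apply/rowP => l; rewrite !mxE eqxx/=; case: eqP => // e; case: nj; exists l.
  exact: e.
apply: (CkS_intro (G := G) oS (cg _ (fun x Ax => Ck_cont Cg Ax))) => [x Ax i|i].
  have dgi : derivable (g : _ -> R^o) (sel x) (sel (delta_mx 0 i)).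
    case: (dsel i) => [[j [_ ->]]|->]; last exact: derivable0.
    by have [] := dg _ Ax j.
  have E : (fun t : R => t^-1 *: ((((fun x => g (sel x)) : _ -> R^o) \o shift x) (t *: delta_mx 0 i)
       - g (sel x))) =
    (fun t : R => t^-1 *: (((g : _ -> R^o) \o shift (sel x)) (t *: sel (delta_mx 0 i)) - g (sel x))).
    by apply/funext => t /=; rewrite selD.
  by split; rewrite /derivable /derive E.
case: (dsel i) => [[j [_ dj]]|dj].
  by rewrite /G dj; exact: IH (Cdg j).
rewrite /G dj; apply: (Ck_ext oS _ (Ck_cst k _ 0)) => x _.
by rewrite derive0.
Qed.

Section Orbits.
Variable X : Type.
Implicit Types (gens : set (X -> X)) (h : X -> X).

Lemma group_orbit_refl gens a : group_orbit gens a a.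
Proof. exact: rst_refl. Qed.

Lemma group_orbit_sym gens a b : group_orbit gens a b -> group_orbit gens b a.
Proof. exact: rst_sym. Qed.

Lemma group_orbit_trans gens a b c :
  group_orbit gens a b -> group_orbit gens b c -> group_orbit gens a c.
Proof. exact: rst_trans. Qed.

Lemma group_orbit_gen gens g a : gens g -> group_orbit gens a (g a).
Proof. by move=> gg; apply: rst_step; exists g. Qed.

Lemma group_orbit_homo (Y : Type) (gens : set (Y -> Y)) (gens' : set (X -> X)) (P : Y -> X) :
  (forall g, gens g -> forall a, group_orbit gens' (P a) (P (g a))) ->
  forall a b, group_orbit gens a b -> group_orbit gens' (P a) (P b).
Proof.
move=> H a b; elim=> {a b} [a b [g gg ->]|a|a b _|a b c _ + _].
- exact: H.
- exact: group_orbit_refl.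
- exact: group_orbit_sym.
- exact: group_orbit_trans.
Qed.

(** Forward iterates alone describe the orbit, so no inverse of [h] has to be named. Injectivity
    enters in transitivity, to cancel common iterates when two points reach the same third one. *)
Lemma group_orbit1P h : injective h -> forall a b,
  group_orbit [set h] a b <-> exists n, b = iter n h a \/ a = iter n h b.
Proof.
move=> h_inj a b; have iter_inj n : injective (iter n h).
  by elim: n => // n IH x y /= /h_inj /IH.
have tr x y z : (exists n, y = iter n h x \/ x = iter n h y) ->
    (exists n, z = iter n h y \/ y = iter n h z) ->
    exists n, z = iter n h x \/ x = iter n h z.
  move=> [m [->|->]] [n [->|]].
  - by exists (n + m)%N; left; rewrite iterD.
  - case: (leqP n m) => nm e.
      exists (m - n)%N; left; apply: (iter_inj n); rewrite -iterD subnKC//.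
    exists (n - m)%N; right; apply: (iter_inj m); rewrite -iterD subnKC// 1?ltnW//.
  - case: (leqP n m) => nm.
      by exists (m - n)%N; right; rewrite -iterD subnK.
    by exists (n - m)%N; left; rewrite -iterD subnK// ltnW.
  - by move=> ->; exists (m + n)%N; right; rewrite iterD.
split.
  elim=> {a b} [a b [_ -> ->]|a|a b _ [n [->|->]]|a b c _ + _].
  - by exists 1%N; left.
  - by exists 0%N; left.
  - by exists n; right.
  - by exists n; left.
  - exact: tr.
have it n x : group_orbit [set h] x (iter n h x).
  elim: n => [|n IH]; first exact: group_orbit_refl.
  exact: (group_orbit_trans IH (@group_orbit_gen [set h] h _ erefl)).
by move=> [n [->|->]]; [exact: it|exact: group_orbit_sym].
Qed.

End Orbits.

Definition C2row (R : realType) (p : R[i] * R[i]) : 'rV[R]_4 :=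
  \row_j nth 0 [:: complex.Re p.1; complex.Im p.1; complex.Re p.2; complex.Im p.2] j.

Lemma C2rowK (R : realType) : cancel (@C2row R) (@C2coord R).
Proof. by move=> [[a b] [c d]]; rewrite /C2coord !mxE. Qed.

Lemma C2coordK (R : realType) : cancel (@C2coord R) (@C2row R).
Proof.
move=> v; apply/rowP => -[[|[|[|[|//]]]] hj]; rewrite !mxE/=;
  by congr (v _ _); apply: val_inj.
Qed.

Definition select (R : realType) (s : 'I_2 -> 'I_4) (x : 'rV[R]_4) : 'rV[R]_2 :=
  \row_j x 0 (s j).

(** * Comparison of two orbit spaces through a parametrization of the punctured plane *)

Section Quotient.
Variables (R : realType) (f : normal_form R) (Q : 'rV[R]_2 -> 'rV[R]_2).
Variables (gens : set ('rV[R]_2 -> 'rV[R]_2)) (g : 'rV[R]_2 -> 'rV[R]_2).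
Variable sel : 'I_2 -> 'I_4.
Implicit Types a b c v : 'rV[R]_2.
Local Notation re := (real_embed f).
Local Notation pr := (real_coord f).
Local Notation orb := (group_orbit [set cmap f]).
Local Notation deck_orb := (group_orbit gens).
Local Notation P := (fun a => re (Q a)).

Hypothesis gensE : gens = [set (fun v : 'rV[R]_2 => vec2 (v 0 0 + 1) (v 0 1)); g].
Hypothesis g_1 : forall a, g a 0 1 = a 0 1 + 1.
Hypothesis Q_turn : forall a, Q (vec2 (a 0 0 + 1) (a 0 1)) = Q a.
Hypothesis Q_g : forall a, P (g a) = cmap f (P a).
Hypothesis Q_inj : forall a b, Q a = Q b ->
  exists m : int, a = vec2 (b 0 0 + m%:~R) (b 0 1).
Hypothesis Q_neq0 : forall a, Q a != 0.
Hypothesis Q_surj : forall v, v != 0 -> exists a, Q a = v.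
Hypothesis Q_section : forall a, exists (A : set 'rV[R]_2) (L : 'rV[R]_2 -> 'rV[R]_2),
  [/\ open A, A (Q a), Cinfty_on A L, L (Q a) = a & forall v, A v -> Q (L v) = v].
Hypothesis P_smooth : Cinfty_on setT (fun a => C2row (P a)).
Hypothesis cmap_inj : injective (cmap f).
Hypothesis re_inj : injective re.
Hypothesis sel_inj : injective sel.
Hypothesis prE : forall x, pr (C2coord x) = select sel x.
Hypothesis reW : forall v, v != 0 -> W (re v).
Hypothesis reK : cancel re pr.
Hypothesis hopf_chart : forall p, W p ->
  exists2 U : set 'rV[R]_4, charts (hopf f) (U, orb \o @C2coord R) & U (C2row p).
Hypothesis fixedE : forall O, fixed_locus f O <-> exists2 v, v != 0 & O = orb (re v).
Hypothesis fixed_real : forall p, fixed_locus f (orb p) -> re (pr p) = p.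

Lemma deck_orb_turn a (m : int) : deck_orb a (vec2 (a 0 0 + m%:~R) (a 0 1)).
Proof.
have T b : deck_orb b (vec2 (b 0 0 + 1) (b 0 1)).
  have := @group_orbit_gen _ gens (fun v => vec2 (v 0 0 + 1) (v 0 1)) b; apply.
  by rewrite gensE; left.
have N b n : deck_orb b (vec2 (b 0 0 + n%:R) (b 0 1)).
  elim: n => [|n IH]; first by rewrite addr0 vec2_eta; exact: group_orbit_refl.
  by have := group_orbit_trans IH (T _); rewrite vec2_0 vec2_1 -addrA -mulrSr.
case: m => n; first exact: N.
apply: group_orbit_sym; have := N (vec2 (a 0 0 + (Negz n)%:~R) (a 0 1)) n.+1.
by rewrite vec2_0 vec2_1 NegzE mulrNz pmulrn subrK vec2_eta.
Qed.

Lemma iter_g n a : P (iter n g a) = iter n (cmap f) (P a) /\ iter n g a 0 1 = a 0 1 + n%:R.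
Proof.
elim: n => [|n [IH1 IH2]]; first by rewrite addr0.
by rewrite !iterS Q_g IH1 g_1 IH2 -addrA -mulrSr.
Qed.

(** [g] lifts [cmap f] through [P], and the fibres of [P] consist of integer turns, which lie in the
    group generated by [gens]. A relation between iterates of [cmap f] thus lifts to one between
    iterates of [g], up to a turn. *)
Lemma deck_orbP a b : deck_orb a b <-> orb (P a) (P b).
Proof.
split.
  apply: (@group_orbit_homo _ _ gens [set cmap f] P) => h; rewrite gensE => -[->|->] c.
    by rewrite Q_turn; exact: group_orbit_refl.
  by rewrite Q_g; exact: (@group_orbit_gen _ [set cmap f] (cmap f)).
have H n c d : P d = iter n (cmap f) (P c) -> deck_orb c d.
  rewrite -(iter_g n c).1 => /re_inj /Q_inj[m ->].
  apply: group_orbit_trans (deck_orb_turn _ m).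
  elim: n => [|n IH]; first exact: group_orbit_refl.
  apply: group_orbit_trans IH _; rewrite iterS.
  by apply: group_orbit_gen; rewrite gensE; right.
by move=> /(group_orbit1P cmap_inj)[n [/H//|/H]]; exact: group_orbit_sym.
Qed.

Definition box (a : 'rV[R]_2) : set 'rV[R]_2 :=
  [set b | `|b 0 0 - a 0 0| < 1 / 2 /\ `|b 0 1 - a 0 1| < 1 / 2].

Lemma near_coord_lt (T : topologicalType) (h : T -> R) (x : T) (c : R) :
  {for x, continuous h} -> `|h x - c| < 1 / 2 -> \forall y \near x, `|h y - c| < 1 / 2.
Proof.
move=> ch hc.
have ca : {for x, continuous (fun y => `|h y - c|)}.
  exact: (cvg_norm (cvgB ch (cvg_cst c))).
exact: (@near_lt_continuous _ _ _ (cst (1 / 2)) x ca (@cst_continuous _ _ _ _) hc).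
Qed.

Lemma open_box a : open (box a).
Proof.
rewrite openE => b [b0 b1].
have c j : {for b, continuous (fun y : 'rV[R]_2 => y 0 j)} by exact: coord_continuous.
exact: filterI (near_coord_lt (c 0) b0) (near_coord_lt (c 1) b1).
Qed.

Lemma box_center a : box a a.
Proof. by rewrite /box/= !subrr normr0. Qed.

(** Half-width 1/2 keeps coordinate differences in a box below 1. The n-th iterate of [g] moves the
    second coordinate by n, so n = 0; what remains is an integer turn of size below 1, hence
    trivial. *)
Lemma box_inj a b c : box a b -> box a c -> deck_orb b c -> b = c.
Proof.
have H n d e : box a d -> box a e -> P e = iter n (cmap f) (P d) -> d = e.
  move=> [d0 d1] [e0 e1]; rewrite -(iter_g n d).1 => /re_inj /Q_inj[m eE].
  have e01 : e 0 1 = d 0 1 + n%:R by rewrite eE vec2_1 (iter_g n d).2.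
  have n0 : n = 0%N.
    case: n eE e01 => // n _ e01; move: d1 e1.
    rewrite e01 !ltr_norml => /andP[d1 d2] /andP[e1' e2].
    have : 1 <= n.+1%:R :> R by rewrite ler1n.
    by move=> n1; exfalso; lra.
  move: eE e01; rewrite n0 /= addr0 => eE e01.
  have e00 : e 0 0 = d 0 0 + m%:~R by rewrite eE vec2_0.
  move: d0 e0; rewrite !ltr_norml => /andP[d0 d0'] /andP[e0 e0'].
  have m1 : m%:~R < 1 :> R by lra.
  have m2 : -1 < m%:~R :> R by lra.
  have m0 : m = 0.
    move: m1 m2; rewrite -[1]/(1%:~R) -[-1]/((-1)%:~R) !ltr_int => m1 m2.
    by apply/eqP; rewrite eq_le -ltzD1 m1; move: m2; rewrite -lezD1 addNr.
  by rewrite eE m0 addr0 vec2_eta.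
move=> ab ac /deck_orbP /(group_orbit1P cmap_inj)[n [/H|/H]]; first exact.
by move=> e; symmetry; exact: e.
Qed.

Let N := orbit_space (R := R) id setT gens.

Lemma box_chart a : charts N (box a, deck_orb).
Proof.
split => //=; first exact: open_box.
move=> b c; rewrite !inE => ab ac e; apply: (box_inj ab ac).
rewrite e; exact: group_orbit_refl.
Qed.

(** Preimage under [P] and saturated image: on orbits [F] and [G] are mutually inverse, and neither
    chooses a representative. *)
Let F (O : set (R[i] * R[i])) : set 'rV[R]_2 := [set a | O (P a)].
Let G (B : set 'rV[R]_2) : set (R[i] * R[i]) := [set p | exists2 a, B a & orb (P a) p].

Lemma F_orb a : F (orb (P a)) = deck_orb a.
Proof. by apply/seteqP; split => b /deck_orbP. Qed.

Lemma G_orb a : G (deck_orb a) = orb (P a).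
Proof.
apply/seteqP; split => p.
  by move=> [b /deck_orbP]; exact: group_orbit_trans.
by move=> ap; exists a => //; exact: group_orbit_refl.
Qed.

Lemma fixedP O : fixed_locus f O -> exists a, O = orb (P a).
Proof. by move=> /fixedE[v /Q_surj[a <-] ->]; exists a. Qed.

Lemma pointsP B : points N B -> exists a, B = deck_orb a.
Proof. by move=> [a _ <-]; exists a. Qed.

(** The extension to an open set of R^4 is the local section [L] after the selection of two real
    coordinates. It has to agree with [F] only where the orbit is in the fixed locus, and there
    [fixed_real] says that the point is recovered from these two coordinates. *)
Lemma smooth_F : smooth_on (hopf f) (fixed_locus f) N F.
Proof.
move=> O /fixedP[a ->].
have [U Uc Ua] := hopf_chart (reW (Q_neq0 a)).
have [A0 [L [oA0 A0a CL La QL]]] := Q_section a.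
exists U, (orb \o @C2coord R), (box a), deck_orb; split => //; split; first exact: box_chart.
have [oU _ _ _] := Uc; rewrite /= in oU.
have oB : open (A0 `&` L @^-1` box a).
  exact: (open_preimage_in oA0 (@open_box a) (fun x Ax => Cinfty_continuous CL Ax)).
have csel : forall x : 'rV[R]_4, {for x, continuous (@select R sel)}.
  move=> x; apply: (@continuous_row R _ 2 (@select R sel)) => j.
  have -> : (fun y => @select R sel y 0 j) = fun y : 'rV[R]_4 => y 0 (sel j).
    by apply/funext => y; rewrite mxE.
  exact: coord_continuous.
pose A := U `&` @select R sel @^-1` (A0 `&` L @^-1` box a).
have oA : open A by exact: (open_preimage_in oU oB (fun x _ => csel x)).
have selP : select sel (C2row (P a)) = Q a by rewrite -prE C2rowK reK.
exists (C2row (P a)), A, (L \o @select R sel); split; split.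
- by rewrite /= C2rowK.
- exact: oA.
- split; first exact: Ua.
  by rewrite /= selP; split => //; rewrite La; exact: box_center.
- by move=> x [].
- by move=> _ [x [_ [_ Lx]] <-].
- move=> j k; apply: (@Ck_sub _ _ _ [set x : 'rV[R]_4 | A0 (select sel x)]).
    by move=> x [_ []].
  exact: (Ck_select sel_inj oA0 (CL j k)).
- move=> x [Ux [A0x Lx]] /= Sx.
  rewrite -(fixed_real Sx) prE -[in LHS](QL _ A0x) F_orb.
  by [].
Qed.

Lemma smooth_G : smooth_on N (points N) (hopf f) G.
Proof.
move=> B /pointsP[a ->].
have [U Uc Ua] := hopf_chart (reW (Q_neq0 a)).
exists (box a), deck_orb, U, (orb \o @C2coord R); split; first exact: box_chart.
split => //; have [oU _ _ _] := Uc; rewrite /= in oU.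
pose A := box a `&` (fun b => C2row (P b)) @^-1` U.
have oA : open A.
  apply: (open_preimage_in (@open_box a) oU) => x _.
  exact: (Cinfty_continuous P_smooth I).
exists a, A, (fun b => C2row (P b)); split; split => //.
- by split; [exact: box_center|].
- by move=> x [].
- by move=> _ [x [_ Ux] <-].
- by move=> j k; apply: (Ck_sub (@subsetT _ A)); exact: P_smooth.
- by move=> x _ _; rewrite /= C2rowK G_orb.
Qed.

Theorem diffeomorphic_quotient :
  diffeomorphic (hopf f) (fixed_locus f) N (points N).
Proof.
exists F, G; split; last by split; [exact: smooth_F|exact: smooth_G].
split.
- by move=> _ [B /fixedP[a ->] <-]; rewrite F_orb; exists a.
- move=> _ [B /pointsP[a ->] <-]; rewrite G_orb; apply/fixedE.
  by exists (Q a).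
- by move=> O; rewrite inE => /fixedP[a ->]; rewrite F_orb G_orb.
- by move=> B; rewrite inE => /pointsP[a ->]; rewrite G_orb F_orb.
Qed.

End Quotient.

(** * Charts and fixed locus of Hopf surfaces *)

Section TriangularContraction.
Variables (R : realType) (r : nat) (A E D : R[i]).
Local Notation N := (@Normc.normc R).
Hypotheses (r_gt0 : (0 < r)%N) (A_neq0 : A != 0) (D_neq0 : D != 0).
Hypotheses (A_lt1 : N A < 1) (D_lt1 : N D < 1) (E_le1 : N E <= 1).

(** A common form of all five classes: [E] is 1 for [IIa] and [IIb], 0 otherwise, and [IIb] has
    [r = 1]. *)
Definition triangular (p : R[i] * R[i]) : R[i] * R[i] := (A * p.1 + E * p.2 ^+ r, D * p.2).

Lemma normc_ge0 (z : R[i]) : 0 <= N z.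
Proof. by case: z => a b; exact: sqrtr_ge0. Qed.

Lemma normc_gt0 (z : R[i]) : (0 < N z) = (z != 0).
Proof.
rewrite lt_def normc_ge0 andbT; congr (~~ _); apply/eqP/eqP => [/Normc.eq0_normc//|->].
exact: Normc.normc0.
Qed.

Lemma normcX (z : R[i]) n : N (z ^+ n) = N z ^+ n.
Proof.
by elim: n => [|n IH]; [exact: Normc.normc1|rewrite !exprS Normc.normcM IH].
Qed.

Lemma triangular_inj : injective triangular.
Proof.
move=> [z w] [z' w'] [e1 /(mulfI D_neq0) e2]; move: e1.
by rewrite e2 /= => /addIr/(mulfI A_neq0) ->.
Qed.

Lemma continuous_normc_coord (x : 'rV[R]_4) :
  {for x, continuous (fun y : 'rV[R]_4 => N (C2coord y).1)} /\
  {for x, continuous (fun y : 'rV[R]_4 => N (C2coord y).2)}.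
Proof.
have H i j : {for x, continuous (fun y : 'rV[R]_4 => Num.sqrt (y 0 i ^+ 2 + y 0 j ^+ 2))}.
  apply: (@continuous_comp _ _ _ (fun y : 'rV[R]_4 => y 0 i ^+ 2 + y 0 j ^+ 2) Num.sqrt).
    have C : Ck_on 0 setT (fun y : 'rV[R]_4 => y 0 i ^+ 2 + y 0 j ^+ 2).
      have oT : open [set: 'rV[R]_4] := openT.
      by apply: CkD => //; apply: CkX => //; exact: Ck_coord.
    exact: (Ck_cont C).
  exact: sqrt_continuous.
by split; exact: H.
Qed.

(** The annulus between [m] and [K] contains radius [c], and scaling by [a] sends it inside the
    inner circle. With [m] and [K] equal to [c] times (1 + a) / 2 and its inverse, the last
    inequality is 4 a < (1 + a)^2. *)
Lemma shrink_bounds (a c : R) : 0 < c -> 0 <= a < 1 ->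
  exists m K, [/\ 0 < m, m < c, c < K & a * K < m].
Proof.
move=> c0 /andP[a0 a1]; exists (c * ((1 + a) / 2)), (c * (2 / (1 + a))).
have a2 : 0 < 1 + a by lra.
have aV : 1 < 2 / (1 + a) by rewrite ltr_pdivlMr// mul1r; lra.
split.
- by rewrite mulr_gt0// divr_gt0.
- by rewrite gtr_pMr//; lra.
- by rewrite ltr_pMr.
- rewrite mulrCA ltr_pM2l// mulrA ltr_pdivrMr// mulrAC ltr_pdivlMr//.
  have : 0 < (1 - a) ^+ 2 by rewrite exprn_gt0// subr_gt0.
  by nra.
Qed.

Lemma triangular_iter2 n p : (iter n triangular p).2 = D ^+ n * p.2.
Proof. by elim: n => [|n IH]; rewrite ?mul1r// iterS /= IH mulrA exprS. Qed.

(** Each point gets a neighbourhood that no positive iterate brings back. If w is nonzero, an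
    annulus in w works, because [|w|] is scaled by [|D|]. If w = 0, an annulus in z works once [|w|]
    is small enough for the shear not to undo the contraction of z; that smallness is preserved by
    the map. *)
Lemma triangular_discontinuous p : W p -> exists U : set 'rV[R]_4,
  [/\ open U, U (C2row p), forall x, U x -> W (C2coord x) &
      forall n x y, U x -> U y -> C2coord y = iter n triangular (C2coord x) -> n = 0%N].
Proof.
case: p => z w Wp.
have [w0|w0] := eqVneq w 0; last first.
  have Nw : 0 < N w by rewrite normc_gt0.
  have ND : 0 <= N D < 1 by rewrite normc_ge0 D_lt1.
  have [m [K [m0 mw wK DK]]] := shrink_bounds Nw ND.
  exists [set x | m < N (C2coord x).2 /\ N (C2coord x).2 < K]; split.
  - rewrite openE => x [x1 x2]; have [_ cx] := continuous_normc_coord x.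
    apply: filterI.
      exact: (@near_lt_continuous _ _ (cst m) _ x (@cst_continuous _ _ _ _) cx x1).
    exact: (@near_lt_continuous _ _ _ (cst K) x cx (@cst_continuous _ _ _ _) x2).
  - by split; rewrite C2rowK.
  - move=> x [x1 _]; case: (C2coord x) x1 => a b /= bm [_ b0].
    by move: bm; rewrite b0 Normc.normc0 ltNge (ltW m0).
  - move=> [//|n] x y [x1 x2] [y1 y2] e; exfalso.
    move: y1; rewrite e triangular_iter2 Normc.normcM normcX exprS => /(lt_trans DK).
    rewrite -mulrA ltNge.
    rewrite ler_pM2l ?normc_gt0// => /negP; apply.
    apply: le_trans (ltW x2); rewrite ler_piMl ?normc_ge0//.
    by rewrite exprn_ile1 ?normc_ge0// ltW.
have z0 : z != 0 by apply/eqP => z0; apply: Wp; rewrite z0 w0.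
have Nz : 0 < N z by rewrite normc_gt0.
have NA : 0 <= N A < 1 by rewrite normc_ge0 A_lt1.
have [m [K [m0 mz zK AK]]] := shrink_bounds Nz NA.
(* The bound 1 gives [|w|^r <= |w|]; the other gives [|A| K + |w| < m], so one step puts z inside
   the inner circle. *)
pose eta := Num.min 1 (m - N A * K).
have eta0 : 0 < eta by rewrite lt_min ltr01 subr_gt0.
pose B x := N (C2coord x).1 < K /\ N (C2coord x).2 < eta.
exists [set x | m < N (C2coord x).1 /\ B x]; split.
- rewrite openE => x [x1 [x2 x3]]; have [cx cx'] := continuous_normc_coord x.
  apply: filterI.
    exact: (@near_lt_continuous _ _ (cst m) _ x (@cst_continuous _ _ _ _) cx x1).
  apply: filterI.
    exact: (@near_lt_continuous _ _ _ (cst K) x cx (@cst_continuous _ _ _ _) x2).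
  exact: (@near_lt_continuous _ _ _ (cst eta) x cx' (@cst_continuous _ _ _ _) x3).
- by rewrite w0; split; [|split]; rewrite C2rowK//= expr0n/= addr0 sqrtr0.
- move=> x [x1 _]; case: (C2coord x) x1 => a b /= am [a0 _].
  by move: am; rewrite a0 Normc.normc0 ltNge (ltW m0).
- have step q : N q.1 < K -> N q.2 < eta -> N (triangular q).1 < m /\ N (triangular q).2 < eta.
    move=> q1 q2; split.
      apply: le_lt_trans (le_normcD _ _) _; rewrite !Normc.normcM normcX.
      have qr : N q.2 ^+ r <= N q.2.
        case: r r_gt0 => // r' _; rewrite exprS ler_piMr ?normc_ge0// exprn_ile1 ?normc_ge0//.
        by apply: ltW; apply: lt_le_trans q2 _; rewrite ge_min lexx.
      have h1 : N A * N q.1 <= N A * K by rewrite ler_wpM2l ?normc_ge0// ltW.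
      have h2 : N E * N q.2 ^+ r <= N q.2.
        apply: le_trans qr; rewrite ler_piMl// exprn_ge0// normc_ge0//.
      have h3 : N q.2 < m - N A * K.
        by apply: lt_le_trans q2 _; rewrite ge_min lexx orbT.
      by lra.
    rewrite Normc.normcM; apply: le_lt_trans q2.
    by rewrite ler_piMl ?normc_ge0// ltW.
  have inv q n : N q.1 < K -> N q.2 < eta ->
      N (iter n.+1 triangular q).1 < m /\ N (iter n.+1 triangular q).2 < eta.
    move=> q1 q2; elim: n => [|n [IH1 IH2]]; first exact: step.
    by rewrite iterS; apply: step => //; apply: lt_trans IH1 (lt_trans mz zK).
  move=> [//|n] x y [_ [x1 x2]] [y1 _] e; exfalso.
  by move: y1; rewrite e ltNge ltW// (inv _ _ x1 x2).1.
Qed.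

Lemma triangular_iter_fixed n p : W p -> iter n triangular p = p -> n = 0%N.
Proof.
move=> Wp e; have [U [_ Up _ H]] := triangular_discontinuous Wp.
by apply: (H n _ _ Up Up); rewrite C2rowK e.
Qed.

End TriangularContraction.

(** * Orbits preserved by the real structure *)

Section FixedLocus.
Variables (R : realType) (f : normal_form R).
Hypothesis f_adm : admissible f.
Hypothesis f_real : real_coefs f \/ in_IIc' f.
Local Notation re := (real_embed f).
Local Notation pr := (real_coord f).
Local Notation conj := (std_conj f).
Local Notation orb := (group_orbit [set cmap f]).

Lemma normr_normc (z : R[i]) : (0 < `|z| < 1) = (z != 0) && (Normc.normc z < 1).
Proof. by rewrite -[`|z|]/((Normc.normc z)%:C) !ltcR normc_gt0. Qed.

Lemma cmap_tri : exists r (A E D : R[i]),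
  [/\ (0 < r)%N, A != 0 /\ Normc.normc A < 1, D != 0 /\ Normc.normc D < 1,
      Normc.normc E <= 1 & cmap f = triangular r A E D].
Proof.
have n0 : Normc.normc 0 <= 1 :> R by rewrite Normc.normc0.
have n1 : Normc.normc 1 <= 1 :> R by rewrite Normc.normc1.
have nX (d : R[i]) n : (0 < n)%N -> d != 0 /\ Normc.normc d < 1 ->
    d ^+ n != 0 /\ Normc.normc (d ^+ n) < 1.
  by move=> n_gt0 [d0 d1]; rewrite expf_neq0// normcX exprn_ilt1// ?normc_ge0// -lt0n.
case: f f_adm => /=.
- move=> a; rewrite normr_normc => /andP[a0 a1]; exists 1%N, a, 0, a; split => //.
  by apply/funext => -[z w]; rewrite /triangular/= mul0r addr0.
- move=> r d [r2]; rewrite normr_normc => /andP[d0 d1].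
  have r0 : (0 < r)%N by exact: leq_trans r2.
  exists r, (d ^+ r), 0, d; split => //; first exact: nX.
  by apply/funext => -[z w]; rewrite /triangular/= mul0r addr0.
- move=> r d [r2]; rewrite normr_normc => /andP[d0 d1].
  have r0 : (0 < r)%N by exact: leq_trans r2.
  exists r, (d ^+ r), 1, d; split => //; first exact: nX.
  by apply/funext => -[z w]; rewrite /triangular/= mul1r.
- move=> a; rewrite normr_normc => /andP[a0 a1]; exists 1%N, a, 1, a; split => //.
  by apply/funext => -[z w]; rewrite /triangular/= mul1r.
- move=> a d []; rewrite !normr_normc => /andP[a0 a1] /andP[d0 d1] _.
  exists 1%N, a, 0, d; split => //.
  by apply/funext => -[z w]; rewrite /triangular/= mul0r addr0.
Qed.

Lemma cmap_inj : injective (cmap f).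
Proof. by have [r [A [E [D [_ [? _] [? _] _ ->]]]]] := cmap_tri; exact: triangular_inj. Qed.

Lemma cmap_iter_fixed n p : W p -> iter n (cmap f) p = p -> n = 0%N.
Proof.
have [r [A [E [D [? [? ?] [? ?] ? ->]]]]] := cmap_tri.
exact: triangular_iter_fixed.
Qed.

(** A neighbourhood without returns injects into the orbit space, which makes it the domain of a
    chart. *)
Lemma hopf_chart p : W p ->
  exists2 U : set 'rV[R]_4, charts (hopf f) (U, orb \o @C2coord R) & U (C2row p).
Proof.
move=> Wp; have [r [A [E [D [r0 [A0 A1] [D0 D1] E1 fE]]]]] := cmap_tri.
have [U [oU Up UW H]] := triangular_discontinuous r0 D0 A1 D1 E1 Wp.
exists U => //; split => //=.
  by move=> _ [x Ux <-]; exact: UW.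
move=> x y; rewrite !inE => Ux Uy e.
have : orb (C2coord x) (C2coord y) by rewrite e; exact: group_orbit_refl.
move=> /(group_orbit1P cmap_inj)[n []]; rewrite fE => e'.
  have n0 := H _ _ _ Ux Uy e'; move: e'; rewrite n0 /= => /(can_inj (@C2coordK R)).
  by [].
have n0 := H _ _ _ Uy Ux e'; move: e'; rewrite n0 /= => /(can_inj (@C2coordK R)).
by [].
Qed.

Lemma IIc'_nreal : in_IIc' f -> real_coefs f = false.
Proof. by move=> [a [-> _ na]] /=; rewrite (negbTE na). Qed.

Lemma std_conjK : involutive conj.
Proof. by move=> [z w]; rewrite /std_conj; case: (real_coefs f); rewrite /= !conjCK. Qed.

(** Real coefficients pass through conjugation. In the other case conjugation interchanges the two
    diagonal coefficients, and the exchange of coordinates restores them. *)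
Lemma std_conj_cmap p : conj (cmap f p) = cmap f (conj p).
Proof.
case: f_real => [fr|/[dup] /IIc'_nreal fn [a [fE _ _]]].
  rewrite /std_conj fr; case: p => z w; move: fr.
  have cr (x y : R[i]) : x \is Num.real -> (x * y)^* = x * y^*.
    by move=> xr; rewrite rmorphM /= conj_Creal.
  case: f => [a|r d|r d|a|a d] /=.
  - by move=> ar; rewrite !cr.
  - by move=> /andP[? ?]; rewrite !cr.
  - by move=> /andP[? ?]; rewrite rmorphD /= !cr// rmorphXn.
  - by move=> ar; rewrite rmorphD /= !cr.
  - by move=> /andP[? ?]; rewrite !cr.
rewrite /std_conj fn; case: p => z w; rewrite fE /=.
by rewrite !rmorphM /= conjCK.
Qed.

Lemma std_conj_iter n p : conj (iter n (cmap f) p) = iter n (cmap f) (conj p).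
Proof. by elim: n => //= n IH; rewrite std_conj_cmap IH. Qed.

Lemma conj_real_embed v : conj (re v) = re v.
Proof.
rewrite /std_conj /real_embed; case: (real_coefs f); rewrite /= ?conjCK//.
by congr pair; exact: conjc_real.
Qed.

Lemma real_embed_coord p : conj p = p -> re (pr p) = p.
Proof.
rewrite /std_conj /real_embed /real_coord; case: (real_coefs f); case: p => -[a b] [c d] e;
  rewrite vec2_0 vec2_1 /=.
  have [b0] : a -i* b = a +i* b := congr1 fst e.
  have [d0] : c -i* d = c +i* d := congr1 snd e.
  by congr (_ +i* _, _ +i* _); lra.
have h : conjc (a +i* b) = c +i* d := congr1 snd e.
by rewrite -h.
Qed.

Lemma real_embedK : cancel re pr.
Proof.
move=> v; rewrite -[RHS]vec2_eta /real_embed /real_coord.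
by case: (real_coefs f).
Qed.

Lemma real_embed_W v : v != 0 -> W (re v).
Proof.
move=> v0 e; move/eqP: v0; apply; rewrite -[v]real_embedK e.
by apply/rowP => i; rewrite /real_coord; case: ifP => _; rewrite !mxE; case: ifP.
Qed.

Lemma W_real_coord p : W p -> conj p = p -> pr p != 0.
Proof.
move=> Wp /real_embed_coord pE; apply/eqP => e; apply: Wp; rewrite -pE e.
by rewrite /real_embed; case: (real_coefs f); rewrite !mxE//=; congr pair; exact: conjc0.
Qed.

Lemma fixedE O : fixed_locus f O <-> exists2 v, v != 0 & O = orb (re v).
Proof.
have iterP := group_orbit1P cmap_inj.
split.
  move=> [[p Wp <-] fO].
  have : orb p (conj p).
    by rewrite /hopf /= -fO; exists p => //; exact: group_orbit_refl.
  move=> /iterP[n np].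
  (* If [p] is instead an iterate of [conj p], applying the involution to that equation gives this
     one. *)
  have cp : conj p = iter n (cmap f) p.
    case: np => // e; apply: (can_inj std_conjK).
    by rewrite std_conjK std_conj_iter -e.
  have n0 : n = 0%N.
    have : iter (n + n) (cmap f) p = p by rewrite iterD -cp -std_conj_iter -cp std_conjK.
    by move=> /(cmap_iter_fixed Wp) /eqP; rewrite addn_eq0 => /andP[/eqP].
  have {}cp : conj p = p by rewrite cp n0.
  exists (pr p); first exact: W_real_coord.
  by rewrite real_embed_coord.
move=> [v v0 ->]; split; first by exists (re v) => //; exact: real_embed_W.
have H p q : orb p q -> orb (conj p) (conj q).
  by move=> /iterP[n [->|->]]; apply/iterP; exists n; rewrite std_conj_iter; [left|right].
apply/seteqP; split => [_ [p vp <-]|p vp].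
  by have := H _ _ vp; rewrite conj_real_embed.
exists (conj p); last exact: std_conjK.
by have := H _ _ vp; rewrite conj_real_embed.
Qed.

(** Not only some point of a fixed orbit but every one is real: forward iterates because [cmap f]
    commutes with the involution, backward ones by injectivity of the iterates. *)
Lemma fixed_real p : fixed_locus f (orb p) -> re (pr p) = p.
Proof.
move=> /fixedE[v v0 e]; apply: real_embed_coord.
have : orb (re v) p by rewrite -e; exact: group_orbit_refl.
move=> /(group_orbit1P cmap_inj)[n [->|e']].
  by rewrite std_conj_iter conj_real_embed.
have iter_inj : injective (iter n (cmap f)).
  by elim: n {e'} => // n IH x y /= /cmap_inj /IH.
by apply: iter_inj; rewrite -std_conj_iter -e' conj_real_embed.
Qed.

End FixedLocus.

(** * Torus and Klein bottle *)

Lemma Cinfty_vec2 (R : realType) m (U : set 'rV[R]_m) (g h : 'rV[R]_m -> R) : open U ->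
  (forall k, Ck_on k U g) -> (forall k, Ck_on k U h) ->
  Cinfty_on U (fun x => vec2 (g x) (h x)).
Proof.
move=> oU Cg Ch j k; case: (eqVneq j 0) => [->|j0].
  by apply: (Ck_ext oU _ (Cg k)) => x _; rewrite vec2_0.
by apply: (Ck_ext oU _ (Ch k)) => x _; rewrite mxE (negbTE j0).
Qed.

Section SpiralQuotient.
Variables (R : realType) (f : normal_form R).
Hypotheses (f_adm : admissible f) (f_real : real_coefs f \/ in_IIc' f).
Variables (r : nat) (p q k M : R).
Hypotheses (r_gt0 : (0 < r)%N) (p_gt0 : 0 < p) (q_gt0 : 0 < q) (M_gt0 : 0 < M).
Hypothesis k_cond : k = 0 \/ p = r%:R * q /\ `|k| <= p.
Local Notation re := (real_embed f).
Local Notation spiral := (spiral r p q k M).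
Implicit Types (a b v : 'rV[R]_2).

(** The affine change of angle normalizes the gluing: [rho = tau] absorbs the translation in (tau +
    s, t + 1), and [kappa = tau / 2] moves a fixed angle of the reflection tau - s to 0. *)
Lemma diffeomorphic_spiral (rho kappa : R) (g : 'rV[R]_2 -> 'rV[R]_2) :
    (forall a, g a 0 1 = a 0 1 + 1) ->
    (forall a, cmap f (re (spiral (a 0 0 + rho * a 0 1 + kappa) (a 0 1))) =
      re (spiral (g a 0 0 + rho * g a 0 1 + kappa) (g a 0 1))) ->
  let N := orbit_space (R := R) id setT
    [set (fun v : 'rV[R]_2 => vec2 (v 0 0 + 1) (v 0 1)); g] in
  diffeomorphic (hopf f) (fixed_locus f) N (points N).
Proof.
move=> g_1 g_step.
pose Q a := spiral (a 0 0 + rho * a 0 1 + kappa) (a 0 1).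
(* The coordinates read by [real_coord]: both real parts for real coefficients, otherwise the real
   and imaginary parts of the first component. *)
pose sel (j : 'I_2) : 'I_4 := if j == 0 then 0 else if real_coefs f then inord 2 else inord 1.
have oT n : open [set: 'rV[R]_n] := openT.
have CQ n : Ck_on n setT (fun a => Q a 0 0) /\ Ck_on n setT (fun a => Q a 0 1).
  have Cs : Ck_on n setT (fun a => 2 * pi * (a 0 0 + rho * a 0 1 + kappa)).
    apply: CkZ => //; apply: CkD => //; last exact: Ck_cst.
    by apply: CkD => //; [|apply: CkZ => //]; exact: Ck_coord.
  have Ct : Ck_on n setT (fun a : 'rV[R]_2 => a 0 1) by exact: Ck_coord.
  have [Cc CS] := Ck_cos_sin (oT 2%N) Cs.
  have Ce (c : R) : Ck_on n setT (fun a : 'rV[R]_2 => expR (c * a 0 1)).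
    by apply: Ck_expR => //; exact: CkZ.
  split; last first.
    by apply: (Ck_ext (oT 2%N) _ (CkM (oT 2%N) (Ce (- q)) CS)) => a _; rewrite vec2_1.
  have Cp : Ck_on n setT (fun a => Num.sqrt (profile r (sin (2 * pi * (a 0 0 + rho * a 0 1 + kappa))))).
    by apply: Ck_sqrt => //; [move=> a _; exact: profile_gt0|exact: Ck_profile].
  have Ck' : Ck_on n setT (fun a : 'rV[R]_2 => a 0 1 * k).
    by apply: CkM => //; exact: Ck_cst.
  have := CkM (oT 2%N) (CkZ M (oT 2%N) (Ce (- p)))
    (CkD (oT 2%N) (CkM (oT 2%N) Cc Cp) (CkM (oT 2%N) Ck' (CkX r (oT 2%N) CS))).
  by apply: Ck_ext => // a _; rewrite vec2_0.
apply: (@diffeomorphic_quotient R f Q _ g sel).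
- by [].
- exact: g_1.
- move=> a; rewrite /Q vec2_0 vec2_1 -[RHS](spiral_turn r p q k M _ _ 1).
  by congr spiral; rewrite mulr1z; ring.
- by move=> a; rewrite g_step.
- move=> a b /(spiral_inj r_gt0 p_gt0 q_gt0 M_gt0 k_cond)[e1 [m e0]]; exists m.
  rewrite -[LHS]vec2_eta -e1; congr vec2.
  by move: e0; rewrite -e1 => e0; lra.
- by move=> a; exact: spiral_neq0.
- move=> v v0; have [s sv] := spiral_surj r_gt0 p_gt0 q_gt0 M_gt0 k_cond v0.
  set t := time _ _ _ _ _ _ in sv.
  exists (vec2 (s - rho * t - kappa) t); rewrite /Q vec2_0 vec2_1 -[RHS]sv.
  by congr spiral; ring.
- move=> a; have [A [sigma [oA Aa AV Csigma [sa Hs]]]] :=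
    spiral_local_section r_gt0 p_gt0 q_gt0 M_gt0 k_cond
      (a 0 0 + rho * a 0 1 + kappa) (a 0 1).
  exists A, (fun v => vec2 (sigma v - rho * time r p q k M v - kappa) (time r p q k M v)).
  have CT n : Ck_on n A (time r p q k M) by exact: (Ck_sub AV (Ck_time r_gt0 _ _ _ _ n)).
  split => //.
  + apply: Cinfty_vec2 => // n; apply: CkB => //; last exact: Ck_cst.
    by apply: CkB => //; exact: CkZ.
  + by rewrite sa time_spiral// -[RHS]vec2_eta; congr vec2; ring.
  + move=> v Av; rewrite /Q vec2_0 vec2_1 -[RHS](Hs v Av); congr spiral; ring.
- move=> j n; have [C0 C1] := CQ n; have CN := CkN (oT 2%N) C1.
  have C00 := Ck_cst n [set: 'rV[R]_2] (0 : R).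
  rewrite /real_embed; case: (real_coefs f); case: j => -[|[|[|[|//]]]] hj.
  + by apply: (Ck_ext (oT 2%N) _ C0) => a _; rewrite [RHS]mxE.
  + by apply: (Ck_ext (oT 2%N) _ C00) => a _; rewrite [RHS]mxE.
  + by apply: (Ck_ext (oT 2%N) _ C1) => a _; rewrite [RHS]mxE.
  + by apply: (Ck_ext (oT 2%N) _ C00) => a _; rewrite [RHS]mxE.
  + by apply: (Ck_ext (oT 2%N) _ C0) => a _; rewrite [RHS]mxE.
  + by apply: (Ck_ext (oT 2%N) _ C1) => a _; rewrite [RHS]mxE.
  + by apply: (Ck_ext (oT 2%N) _ C0) => a _; rewrite [RHS]mxE.
  + by apply: (Ck_ext (oT 2%N) _ CN) => a _; rewrite [RHS]mxE.
- exact: cmap_inj.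
- exact: (can_inj (@real_embedK R f)).
- move=> i j; rewrite /sel; case: (real_coefs f);
    case: (eqVneq i 0) => [->|i0]; case: (eqVneq j 0) => [->//|j0] /(congr1 val);
    rewrite /= ?inordK// => _; apply/val_inj => /=;
    by move: i0 j0; case: i => -[|[|//]] //= hi; case: j => -[|[|//]].
- move=> x; rewrite /real_coord /select -[RHS]vec2_eta !mxE /sel /=.
  by case: (real_coefs f); congr vec2; congr (x _ _); apply: val_inj; rewrite /= ?inordK.
- by move=> v; exact: real_embed_W.
- exact: real_embedK.
- by move=> u; exact: hopf_chart.
- by move=> O; exact: fixedE.
- by move=> u; exact: fixed_real.
Qed.

Lemma diffeomorphic_torus (tau : R) :
    (forall s t, cmap f (re (spiral s t)) = re (spiral (s + tau) (t + 1))) ->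
  diffeomorphic (hopf f) (fixed_locus f) (torus R) (points (torus R)).
Proof.
move=> step; apply: (diffeomorphic_spiral (rho := tau) (kappa := 0)) => a.
  by rewrite vec2_1.
by rewrite step vec2_0 vec2_1; congr (re (spiral _ _)); ring.
Qed.

Lemma diffeomorphic_klein_bottle (tau : R) :
    (forall s t, cmap f (re (spiral s t)) = re (spiral (tau - s) (t + 1))) ->
  diffeomorphic (hopf f) (fixed_locus f) (klein_bottle R) (points (klein_bottle R)).
Proof.
move=> step; apply: (diffeomorphic_spiral (rho := 0) (kappa := tau / 2)) => a.
  by rewrite vec2_1.
by rewrite step vec2_0 vec2_1; congr (re (spiral _ _)); field.
Qed.

End SpiralQuotient.

(** * Determinant of the real part and its action on angle and time *)

Lemma det_mx22 (R : comRingType) (J : 'M[R]_2) : \det J = J 0 0 * J 1 1 - J 0 1 * J 1 0.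
Proof.
rewrite (expand_det_row _ 0) !big_ord_recl big_ord0 addr0 /cofactor !det_mx11 !mxE.
have l00 : lift (0 : 'I_2) (0 : 'I_1) = 1 by apply: val_inj.
have l10 : lift (1 : 'I_2) (0 : 'I_1) = 0 by apply: val_inj.
by rewrite !l00 l10 /= expr0 expr1 mul1r mulN1r mulrN.
Qed.

Lemma det_jacobian_vec2 (R : realType) (g h : 'rV[R]_2 -> R) (v : 'rV[R]_2) (a b c d : R) :
    differentiable (g : _ -> R^o) v -> differentiable (h : _ -> R^o) v ->
    is_derive v (delta_mx 0 0) (g : _ -> R^o) a ->
    is_derive v (delta_mx 0 0) (h : _ -> R^o) b ->
    is_derive v (delta_mx 0 1) (g : _ -> R^o) c ->
    is_derive v (delta_mx 0 1) (h : _ -> R^o) d ->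
  \det (jacobian (fun u => vec2 (g u) (h u)) v) = a * d - b * c.
Proof.
move=> dg dh ga hb gc hd; set G := fun u => _.
have GE : G = (fun u => g u *: (delta_mx 0 0 : 'rV[R]_2)) + (fun u => h u *: (delta_mx 0 1 : 'rV[R]_2)).
  apply/funext => u; apply/rowP => j; rewrite !mxE.
  by case: j => -[|[|//]] hj; rewrite /= ?mulr0 ?mulr1 ?addr0 ?add0r.
have dG : differentiable G v.
  by rewrite GE; apply: differentiableD; apply: differentiableZl.
have JE i j : jacobian G v i j = 'D_(delta_mx 0 i) (fun u => G u 0 j : R^o) v.
  have := deriveEjacobian (delta_mx 0 i) dG; rewrite -rowE => /rowP/(_ j).
  rewrite derive_mx; last exact: diff_derivable.
  by rewrite !mxE => <-.
have G0 : (fun u => G u 0 0 : R^o) = g by apply/funext => u; rewrite vec2_0.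
have G1 : (fun u => G u 0 1 : R^o) = h by apply/funext => u; rewrite vec2_1.
rewrite det_mx22 !JE G0 G1.
rewrite (@derive_val _ _ _ _ _ _ _ ga) (@derive_val _ _ _ _ _ _ _ hb).
by rewrite (@derive_val _ _ _ _ _ _ _ gc) (@derive_val _ _ _ _ _ _ _ hd).
Qed.

Section SpiralStep.
Variables (R : realType) (r : nat) (p q k M : R).
Hypothesis k_cond : k = 0 \/ p = r%:R * q /\ `|k| <= p.
Local Notation spiral := (spiral r p q k M).

(** The map is the reflection diag(sa, sd) composed with the time-one flow. The equation
    [k * sd ^+ r = k * sa] says that the two commute, and [e = a * M * k] is the shear coefficient
    of the flow in the unscaled coordinate. *)
Lemma spiral_step (a d e sa sd s s' t : R) :
    a = sa * expR (- p) -> d = sd * expR (- q) -> sd ^+ 2 = 1 ->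
    k * sd ^+ r = k * sa -> e = a * M * k ->
    cos (2 * pi * s') = sa * cos (2 * pi * s) ->
    sin (2 * pi * s') = sd * sin (2 * pi * s) ->
  vec2 (a * spiral s t 0 0 + e * spiral s t 0 1 ^+ r) (d * spiral s t 0 1) =
  spiral s' (t + 1).
Proof.
move=> aE dE sd2 ksd eE cE sE; rewrite /spiral cE sE !vec2_0 !vec2_1.
have -> : profile r (sd * sin (2 * pi * s)) = profile r (sin (2 * pi * s)).
  by apply: eq_bigr => i _; rewrite [(sd * _) ^+ 2]exprMn sd2 mul1r.
set c := cos _; set y := sin _; set S := Num.sqrt _.
have ke := k_expR k_cond (- t); rewrite !mulrN -!mulNr in ke.
rewrite !mulrDr !mulr1 !expRD; congr vec2; last by rewrite dE; ring.
rewrite eE !exprMn (_ : _ * k * (_ * _) = a * M * (k * expR (- q * t) ^+ r) * y ^+ r); last by ring.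
rewrite ke [X in _ = X](_ : _ = M * (expR (- p * t) * expR (- p)) *
  (sa * c * S + (t + 1) * (k * sd ^+ r) * y ^+ r)); last by ring.
by rewrite ksd aE; ring.
Qed.

End SpiralStep.

(** * Contractions with real coefficients *)

Section RealCase.
Variables (R : realType) (f : normal_form R).
Hypotheses (f_adm : admissible f) (f_re : real_coefs f).

Lemma real_lt1 (x : R) : (0 < `|x%:C| < 1) = (0 < `|x| < 1).
Proof.
rewrite -[`|x%:C|]/((Num.sqrt (x ^+ 2 + 0 ^+ 2))%:C) !ltcR.
by rewrite expr0n /= addr0 sqrtr_sqr.
Qed.

Lemma real_normal_form : exists (r : nat) (a d e : R),
  [/\ (0 < r)%N, 0 < `|a| < 1, 0 < `|d| < 1, e = 0 \/ e = 1 /\ a = d ^+ r &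
      forall v, cmap f (real_embed f v) =
        real_embed f (vec2 (a * v 0 0 + e * v 0 1 ^+ r) (d * v 0 1))].
Proof.
rewrite /real_embed f_re; move: f_adm f_re; case: f => /=.
- move=> al + /complex_realP[a aE]; rewrite {al}aE real_lt1 => a1.
  exists 1%N, a, a, 0; split => //; first by left.
  by move=> v; rewrite vec2_0 vec2_1 mul0r addr0 -!rmorphM.
- move=> r de + /andP[_ /complex_realP[d dE]]; rewrite {de}dE real_lt1 => -[r2 d1].
  have r0 : (0 < r)%N by exact: leq_trans r2.
  (* The map is diagonal, so it is treated with exponent 1, for which the curve is the round
     circle. *)
  exists 1%N, (d ^+ r), d, 0; split => //; last 2 first.
  + by left.
  + by move=> v; rewrite vec2_0 vec2_1 mul0r addr0 -rmorphXn -!rmorphM.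
  move/andP: d1 => [d0 d1]; rewrite normrX exprn_gt0//= exprn_ilt1// -lt0n.
  by [].
- move=> r de + /andP[_ /complex_realP[d dE]]; rewrite {de}dE real_lt1 => -[r2 d1].
  have r0 : (0 < r)%N by exact: leq_trans r2.
  exists r, (d ^+ r), d, 1; split => //; last 2 first.
  + by right.
  + by move=> v; rewrite vec2_0 vec2_1 mul1r -!rmorphXn -!rmorphM -rmorphD.
  move/andP: d1 => [d0 d1]; rewrite normrX exprn_gt0//= exprn_ilt1// -lt0n.
  by [].
- move=> al + /complex_realP[a aE]; rewrite {al}aE real_lt1 => a1.
  exists 1%N, a, a, 1; split => //; first by right.
  by move=> v; rewrite vec2_0 vec2_1 mul1r -!rmorphM -rmorphD.
- move=> al de + /andP[/complex_realP[a aE] /complex_realP[d dE]].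
  rewrite {al}aE {de}dE !real_lt1 => -[a1 d1 _].
  exists 1%N, a, d, 0; split => //; first by left.
  by move=> v; rewrite vec2_0 vec2_1 mul0r addr0 -!rmorphM.
Qed.

Lemma real_dichotomy :
  (forall v, 0 < real_part_det f v) /\
     diffeomorphic (hopf f) (fixed_locus f) (torus R) (points (torus R)) \/
  (forall v, real_part_det f v < 0) /\
     diffeomorphic (hopf f) (fixed_locus f) (klein_bottle R) (points (klein_bottle R)).
Proof.
have [r [a [d [e [r0 a1 d1 ae fE]]]]] := real_normal_form.
have detE v : real_part_det f v = a * d.
  rewrite /real_part_det (_ : real_part f = fun u => vec2 (a * u 0 0 + e * u 0 1 ^+ r) (d * u 0 1));
    last by apply/funext => u; rewrite /real_part fE real_embedK.
  have df (c : R) j n : differentiable ((fun u : 'rV[R]_2 => c * u 0 j ^+ n) : _ -> R^o) v.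
    apply: differentiableM; first exact: differentiable_cst.
    by apply: differentiable_pow; exact: differentiable_coord.
  have df1 (c : R) j : differentiable ((fun u : 'rV[R]_2 => c * u 0 j) : _ -> R^o) v.
    by apply: differentiableM; [exact: differentiable_cst|exact: differentiable_coord].
  have dd w : is_derive v w ((fun u : 'rV[R]_2 => d * u 0 1) : _ -> R^o) (d * w 0 1).
    exact: (is_deriveZ d (is_derive_coord v w 1)).
  have da w : is_derive v w ((fun u : 'rV[R]_2 => a * u 0 0 + e * u 0 1 ^+ r) : _ -> R^o)
      (a * w 0 0 + e * (r%:R * v 0 1 ^+ r.-1 * w 0 1)).
    rewrite (_ : (fun u => _) = (fun u : 'rV[R]_2 => a * u 0 0) +
      e \*: (fun u : 'rV[R]_2 => u 0 1 : R^o) ^+ r); last first.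
      by apply/funext => u; rewrite !fctE.
    exact: (is_deriveD (is_deriveZ a (is_derive_coord v w 0))
      (is_deriveZ e (is_deriveX r (is_derive_coord v w 1)))).
  have dg : differentiable ((fun u : 'rV[R]_2 => a * u 0 0 + e * u 0 1 ^+ r) : _ -> R^o) v.
    exact: differentiableD.
  rewrite (det_jacobian_vec2 dg (df1 d 1) (da _) (dd _) (da _) (dd _)) !mxE /=.
  by ring.
have [[a0 a1'] [d0 d1']] := (andP a1, andP d1).
have expa : expR (- - ln `|a|) = `|a| by rewrite opprK lnK.
have expd : expR (- - ln `|d|) = `|d| by rewrite opprK lnK.
have p0 : 0 < - ln `|a| by rewrite oppr_gt0 ln_lt0.
have q0 : 0 < - ln `|d| by rewrite oppr_gt0 ln_lt0.
set p := - ln `|a| in p0 expa; set q := - ln `|d| in q0 expd.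
have aE : a = Num.sg a * expR (- p) by rewrite expa mulr_sg_norm.
have dE : d = Num.sg d * expR (- q) by rewrite expd mulr_sg_norm.
have an0 : a != 0 by rewrite -normr_gt0.
have dn0 : d != 0 by rewrite -normr_gt0.
have sd2 : Num.sg d ^+ 2 = 1 by rewrite sqr_sg dn0.
(* [e = a * M * k] makes the shear terms agree; then [M] is chosen so that [`|k| = p]. *)
have [k [M [M0 k_cond ksd eE]]] : exists k M : R, [/\ 0 < M,
    k = 0 \/ p = r%:R * q /\ `|k| <= p, k * Num.sg d ^+ r = k * Num.sg a & e = a * M * k].
  case: ae => [->|[-> adr]]; first by exists 0, 1; split; rewrite ?mul0r ?mulr0//; left.
  exists (Num.sg a * p), (`|a| * p)^-1; split.
  - by rewrite invr_gt0 mulr_gt0.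
  - right; split; last by rewrite normrM normr_sg an0 mul1r gtr0_norm.
    by rewrite /p /q adr normrX lnXn// mulrN mulr_natl.
  - by rewrite -sgrX -adr.
  - rewrite [RHS](_ : _ = (Num.sg a * a) * p / (`|a| * p)); last by ring.
    by rewrite -normrEsg divff// mulf_neq0// ?normr_eq0// gt_eqF.
have cE := @cosDpi R; have sE := @sinDpi R.
have step tau (s s' t : R) : s' = tau s ->
    cos (2 * pi * tau s) = Num.sg a * cos (2 * pi * s) ->
    sin (2 * pi * tau s) = Num.sg d * sin (2 * pi * s) ->
    cmap f (real_embed f (spiral r p q k M s t)) = real_embed f (spiral r p q k M s' (t + 1)).
  move=> -> cs sn; rewrite fE; congr (real_embed f _).
  exact: (@spiral_step R r p q k M k_cond a d e _ _ s _ t aE dE sd2 ksd eE cs sn).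
have torusP tau :=
  @diffeomorphic_torus R f f_adm (or_introl f_re) r p q k M r0 p0 q0 M0 k_cond tau.
have kleinP tau :=
  @diffeomorphic_klein_bottle R f f_adm (or_introl f_re) r p q k M r0 p0 q0 M0 k_cond tau.
have half s : 2 * pi * (s + 1 / 2) = 2 * pi * s + pi :> R by field.
have halfN s : 2 * pi * (1 / 2 - s) = - (2 * pi * s) + pi :> R by field.
(* The signs of [a] and [d] act on the angle [s] as follows: identity for (+, +), [- s] for (+, -),
   [1 / 2 - s] for (-, +) and the half turn [s + 1 / 2] for (-, -). *)
case: (ltrgt0P a) an0 => // sa _; case: (ltrgt0P d) dn0 => // sd _.
- left; split; first by move=> v; rewrite detE mulr_gt0.
  apply: (torusP 0) => s t; apply: (step (fun s => s)); rewrite ?addr0//.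
    by rewrite gtr0_sg// mul1r.
  by rewrite gtr0_sg// mul1r.
- right; split; first by move=> v; rewrite detE nmulr_llt0.
  apply: (kleinP 0) => s t; apply: (step (fun s => - s)); rewrite ?sub0r//.
    by rewrite gtr0_sg// mul1r mulrN cosN.
  by rewrite ltr0_sg// mulN1r mulrN sinN.
- right; split; first by move=> v; rewrite detE nmulr_rlt0.
  apply: (kleinP (1 / 2)) => s t; apply: (step (fun s => 1 / 2 - s)) => //.
    by rewrite ltr0_sg// mulN1r halfN cE cosN.
  by rewrite halfN gtr0_sg// mul1r sE sinN opprK.
- left; split; first by move=> v; rewrite detE nmulr_rgt0.
  apply: (torusP (1 / 2)) => s t; apply: (step (fun s => s + 1 / 2)) => //.
    by rewrite ltr0_sg// mulN1r half cE.
  by rewrite ltr0_sg// mulN1r half sE.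
Qed.
End RealCase.

(** * The class of conjugate diagonal coefficients *)

Section ConjugateCase.
Variables (R : realType) (alpha : R[i]).
Hypotheses (alpha_lt1 : 0 < `|alpha| < 1) (alpha_nreal : alpha \isn't Num.real).
Let f := IIc alpha (alpha^*).
Hypothesis f_adm : admissible f.

Lemma conjugate_real_part v : cmap f (real_embed f v) = real_embed f
  (vec2 (complex.Re alpha * v 0 0 - complex.Im alpha * v 0 1)
        (complex.Re alpha * v 0 1 + complex.Im alpha * v 0 0)).
Proof.
rewrite /real_embed /= (negbTE alpha_nreal) /= vec2_0 vec2_1 -rmorphM.
case: alpha => u w /=.
by [].
Qed.

Lemma conjugate_det v : 0 < real_part_det f v.
Proof.
set u := complex.Re alpha; set w := complex.Im alpha.
rewrite /real_part_det (_ : real_part f = fun x => vec2 (u * x 0 0 + - w * x 0 1) (u * x 0 1 + w * x 0 0));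
  last by apply/funext => x; rewrite /real_part conjugate_real_part real_embedK mulNr.
have df (b c : R) i j : differentiable ((fun x : 'rV[R]_2 => b * x 0 i + c * x 0 j) : _ -> R^o) v.
  by apply: differentiableD; apply: differentiableM;
    (exact: differentiable_cst || exact: differentiable_coord).
have dd (b c : R) i j y : is_derive v y ((fun x : 'rV[R]_2 => b * x 0 i + c * x 0 j) : _ -> R^o)
    (b * y 0 i + c * y 0 j).
  exact: (is_deriveD (is_deriveZ b (is_derive_coord v y i)) (is_deriveZ c (is_derive_coord v y j))).
rewrite (det_jacobian_vec2 (df _ _ _ _) (df _ _ _ _)
  (dd _ _ _ _ _) (dd _ _ _ _ _) (dd _ _ _ _ _) (dd _ _ _ _ _)) !mxE /=.
rewrite (_ : _ - _ = u ^+ 2 + w ^+ 2); last by ring.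
move: alpha_lt1; rewrite normr_normc => /andP[+ _]; rewrite -normc_gt0 /u /w.
by case: alpha => ? ? /=; rewrite sqrtr_gt0.
Qed.

(** The real part is multiplication by [alpha] on the complex line. Its modulus is the time-one flow
    with equal rates and no shear, for which [profile] is 1; its argument rotates the angle by [rho]
    turns. *)
Lemma conjugate_torus :
  diffeomorphic (hopf f) (fixed_locus f) (torus R) (points (torus R)).
Proof.
have f' : in_IIc' f by exists alpha.
have [n0 n1] : 0 < Normc.normc alpha /\ Normc.normc alpha < 1.
  by move: alpha_lt1; rewrite normr_normc -normc_gt0 => /andP[].
set n := Normc.normc alpha in n0 n1.
have p0 : 0 < - ln n by rewrite oppr_gt0 ln_lt0// n0.
have expn : expR (- - ln n) = n by rewrite opprK lnK.
set p := - ln n in p0 expn.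
have cs : (complex.Re alpha / n) ^+ 2 + (complex.Im alpha / n) ^+ 2 = 1.
  have n2 : n ^+ 2 = complex.Re alpha ^+ 2 + complex.Im alpha ^+ 2.
    by rewrite /n; case: alpha => u w /=; rewrite sqr_sqrtr// addr_ge0 ?sqr_ge0.
  by rewrite !expr_div_n -mulrDl -n2 divff// expf_neq0// gt_eqF.
have [rho [cr sr]] := ex_angle cs.
have reE : complex.Re alpha = expR (- p) * cos (2 * pi * rho).
  by rewrite expn cr mulrCA divff ?mulr1// gt_eqF.
have imE : complex.Im alpha = expR (- p) * sin (2 * pi * rho).
  by rewrite expn sr mulrCA divff ?mulr1// gt_eqF.
apply: (@diffeomorphic_torus R f f_adm (or_intror f') 1 p p 0 1 _ p0 p0 _ (or_introl erefl) rho) => //.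
move=> s t; rewrite conjugate_real_part; congr (real_embed f _).
rewrite reE imE /spiral !vec2_0 !vec2_1 !mulr0 !mul0r !addr0 !mul1r /profile !big_ord1 !expr0 sqrtr1 !mulr1.
rewrite !mulrDr !mulr1 expRD cosD sinD.
by congr vec2; ring.
Qed.

End ConjugateCase.

Theorem proposition5p13 (R : realType) (f : normal_form R)
    (f_adm : admissible f) (f_real : real_coefs f \/ in_IIc' f) :
  ((forall v : 'rV[R]_2, v != 0 -> 0 < real_part_det f v) /\
     diffeomorphic (hopf f) (fixed_locus f) (torus R) (points (torus R)) \/
   (forall v : 'rV[R]_2, v != 0 -> real_part_det f v < 0) /\
     diffeomorphic (hopf f) (fixed_locus f)
       (klein_bottle R) (points (klein_bottle R))) /\
  (in_IIc' f ->
     diffeomorphic (hopf f) (fixed_locus f) (torus R) (points (torus R))).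
Proof.
have conjugate : in_IIc' f -> (forall v, 0 < real_part_det f v) /\
    diffeomorphic (hopf f) (fixed_locus f) (torus R) (points (torus R)).
  move=> [alpha [fE a1 nreal]]; rewrite fE in f_adm *.
  by split; [exact: conjugate_det|exact: conjugate_torus].
split; last by move=> /conjugate[].
case: f_real => [f_re|/conjugate[detP fT]]; last by left.
by case: (real_dichotomy f_adm f_re) => -[detP fT]; [left|right].
Qed.
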